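(* Let $F$ be an algebraically closed field of characteristic zero, let $n\ge 1$, and let $V$ be a braided vector space of diagonal type over $F$ with basis $x_1,\dots,x_n$ and braiding $C(x_i\otimes x_j)=p_{ij}\,x_j\otimes x_i$, where $p_{ij}\in F^*$ for $1\le i,j\le n$. Let $\mathfrak B(V)$ be the Nichols algebra of $V$, $\mathfrak L(V)\subseteq \mathfrak B(V)$ the Nichols braided Lie algebra of $V$, and $\Gamma(V)$ the pure generalized Dynkin graph of $V$. (i) Let $u$ be a monomial that is non-zero in $\mathfrak B(V)$. Then $\Gamma(u)$ is a connected component of $\Gamma(V)$ if and only if $\mu(u)$ is a maximal element, with respect to inclusion $\subseteq$, of the set $\{\mu(v)\mid v \text{ is a non-zero monomial in } \mathfrak L(V)\}$. (ii) The following conditions are equivalent: (a) $\Gamma(V)$ is connected; (b) $x_nx_{n-1}\cdots x_1\in \mathfrak L(V)$; (c) $x_1x_2\cdots x_n\in \mathfrak L(V)$; (d) there exists a non-zero monomial $u\in\mathfrak L(V)$ with $|\mu(u)|=\dim V$.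
   Context: Nichols algebra: $\mathfrak B(V)$ is the Nichols algebra of the braided vector space $(V,C)$, i.e. the quotient of the tensor algebra $T(V)$ (as a braided Hopf algebra in which the elements of $V$ are primitive) by its largest braided Hopf ideal contained in $\bigoplus_{k\ge 2}V^{\otimes k}$. It is $\mathbb Z^n$-graded with $\deg(x_i)=e_i$, where $e_1,\dots,e_n$ is the standard basis of $\mathbb Z^n$. Bicharacter: let $\chi:\mathbb Z^n\times\mathbb Z^n\to F^*$ be the bicharacter with $\chi(e_i,e_j)=p_{ij}$. For $\mathbb Z^n$-homogeneous elements $u,v\in\mathfrak B(V)$ put $p_{uv}:=\chi(\deg(u),\deg(v))$. Nichols braided Lie algebra: for $\mathbb Z^n$-homogeneous $x,y\in\mathfrak B(V)$ put $[x,y]:=yx-p_{yx}\,xy$, and extend bilinearly to $\mathfrak B(V)$. $\mathfrak L(V)$ is the smallest linear subspace of $\mathfrak B(V)$ that contains $V$ and is closed under $[\ ,\ ]$. Monomials: a monomial is a product $u=h_1h_2\cdots h_m$ in $\mathfrak B(V)$ with $m\ge 1$ and $h_j=x_{i_j}$, $i_j\in\{1,\dots,n\}$. Set $\mu(u):=\{x_{i_1},\dots,x_{i_m}\}$, the set of basis vectors occurring in $u$. When $u\ne 0$, $\mu(u)$ depends only on $u$, since $\mathfrak B(V)$ is $\mathbb Z^n$-graded. Graphs: graphs are simple and undirected. The pure generalized Dynkin graph $\Gamma(V)$ has vertex set $\{1,\dots,n\}$ and an edge between $i$ and $j$ ($i\ne j$) if and only if $p_{ij}p_{ji}\ne 1$.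 For a monomial $u$, $\Gamma(u)$ is the subgraph of $\Gamma(V)$ generated (induced) by $\{i\mid x_i\in\mu(u)\}$. A connected component of a graph is the subgraph induced by an equivalence class of vertices under the relation ''equal or joined by a walk''. *)

(* Defs.v *)
From HB Require Import structures.
From mathcomp Require Import all_boot all_order all_algebra.
From mathcomp Require Import boolp finmap monalg.

Set Implicit Arguments.
Unset Strict Implicit.
Unset Printing Implicit Defensive.

Import GRing.Theory.
Local Open Scope ring_scope.
Local Open Scope quotient_scope.

Section Subspaces.

Variables (F : fieldType) (V : lmodType F).

Definition is_subspace (W : V -> Prop) : Prop :=
  W 0 /\ forall a x y, W x -> W y -> W (a *: x + y).

Definition span (S : V -> Prop) (x : V) : Prop :=
  forall W, is_subspace W -> (forall y, S y -> W y) -> W x.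

Lemma span_subspace S : is_subspace (span S).
Proof.
split=> [W [W0 _] _ //|a x y Sx Sy W sW SW].
by apply: sW.2; [exact: Sx|exact: Sy].
Qed.

Lemma span_in (S : V -> Prop) x : S x -> span S x.
Proof. by move=> Sx W _; exact. Qed.

Lemma subspaceD W x y : is_subspace W -> W x -> W y -> W (x + y).
Proof. by move=> sW Wx Wy; rewrite -[x]scale1r; apply: sW.2. Qed.

Lemma subspaceZ W a x : is_subspace W -> W x -> W (a *: x).
Proof. by move=> sW Wx; rewrite -[_ *: _]addr0; apply: sW.2 => //; apply: sW.1. Qed.

Lemma subspace_sum W (I : Type) (r : seq I) (G : I -> V) : is_subspace W ->
  (forall i, W (G i)) -> W (\sum_(i <- r) G i).
Proof.
move=> sW WG; elim: r => [|i r IHr]; first by rewrite big_nil; apply: sW.1.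
by rewrite big_cons; apply: subspaceD.
Qed.

End Subspaces.

Lemma subspace_preim (F : fieldType) (U V : lmodType F) (phi : U -> V)
  (W : V -> Prop) : linear phi -> is_subspace W -> is_subspace (fun x => W (phi x)).
Proof.
move=> lphi sW; split=> [|a x y Wx Wy]; last by rewrite lphi; apply: sW.2.
suff -> : phi 0 = 0 by apply: sW.1.
by have := lphi (-1) 0 0; rewrite !scaleN1r oppr0 addr0 addNr.
Qed.

Section LinearExtension.

Variables (F : fieldType) (K : choiceType).

Definition linext (V : lmodType F) (h : K -> V) (f : {malg F[K]}) : V :=
  \sum_(k <- msupp f) f@_k *: h k.

Section Theory.
Variable V : lmodType F.
Implicit Types (h : K -> V) (f g : {malg F[K]}).

Lemma linextEw h f (d : {fset K}) : (msupp f `<=` d)%fset ->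
  linext h f = \sum_(k <- d) f@_k *: h k.
Proof.
move=> le; rewrite [LHS](big_fset_incl _ le) => //= x xd /mcoeff_outdom ->.
by rewrite scale0r.
Qed.

Lemma linextU h k : linext h << k >> = h k.
Proof. by rewrite (linextEw _ msuppU_le) big_seq_fset1 mcoeffUU scale1r. Qed.

Lemma linextP h : linear (linext h).
Proof.
move=> a f g; pose d := (msupp f `|` msupp g)%fset.
have le : (msupp (a *: f + g) `<=` d)%fset.
  apply: fsubset_trans (msuppD_le _ _) _.
  by apply: fsetUSS; [exact: msuppZ_le|exact: fsubset_refl].
rewrite (linextEw _ le) (linextEw _ (fsubsetUl _ _ : (msupp f `<=` d)%fset)).
rewrite (linextEw _ (fsubsetUr _ _ : (msupp g `<=` d)%fset)).
rewrite scaler_sumr -big_split /=; apply: eq_bigr => k _.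
by rewrite mcoeffD mcoeffZ scalerDl scalerA.
Qed.

Lemma linext_lin a h h' f :
  linext (fun k => a *: h k + h' k) f = a *: linext h f + linext h' f.
Proof.
rewrite /linext scaler_sumr -big_split; apply: eq_bigr => k _.
by rewrite scalerDr !scalerA mulrC.
Qed.

Lemma linext_linr (U : lmodType F) (h : K -> U -> V) f :
  (forall k, linear (h k)) -> linear (fun x => linext (h^~ x) f).
Proof.
by move=> lh a x y; rewrite -linext_lin; apply: eq_bigr => k _; rewrite lh.
Qed.

End Theory.

Lemma malg_subspace (W : {malg F[K]} -> Prop) : is_subspace W ->
  (forall k, W << k >>) -> forall f, W f.
Proof.
move=> sW WU f; rewrite [f]monalgE; apply: subspace_sum => // k.
suff -> : << f@_k *g k >> = f@_k *: << k >> by apply: subspaceZ.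
by apply/malgP=> l; rewrite mcoeffZ !mcoeffU mulr_natr.
Qed.

Lemma linear_eq (V : lmodType F) (phi psi : {malg F[K]} -> V) :
  linear phi -> linear psi -> (forall k, phi << k >> = psi << k >>) -> phi =1 psi.
Proof.
move=> lphi lpsi E; apply: malg_subspace => //; split=> [|a x y Ex Ey].
  have L0 (xi : {malg F[K]} -> V) : linear xi -> xi 0 = 0.
    by move=> lxi; have := lxi (-1) 0 0; rewrite !scaleN1r oppr0 addr0 addNr.
  by rewrite !L0.
by rewrite lphi lpsi Ex Ey.
Qed.

End LinearExtension.

Lemma malg_scalerAr (F : fieldType) (K : monomType) (a : F) (f g : {malg F[K]}) :
  a *: (f * g) = f * (a *: g).
Proof.
apply/malgP=> k; rewrite (mcoeffZ a (f * g)) (mcoeffMl f g).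
rewrite (mcoeffMlw k (fsubset_refl (msupp f)) (msuppZ_le a g)).
rewrite (big_distrr a) /=; apply: eq_bigr => u _.
rewrite (big_distrr a) /=; apply: eq_bigr => v _.
by rewrite (mcoeffZ a g) mulrnAr mulrCA.
Qed.

Section TensorAlgebra.

Variables (F : fieldType) (n : nat) (p : 'M[F]_n).

(* The words in 'I_n are a basis of T(V), a word of size k lying in V^{(x) k};
   pairs of words are a basis of T(V) (x) T(V). *)
Local Notation word := {fmonom 'I_n}.
Definition tensor_alg := {malg F[word]}.
Definition tensor_sq := {malg F[(word * word)%type]}.
HB.instance Definition _ := GRing.Lalgebra.on tensor_alg.
HB.instance Definition _ :=
  GRing.Lalgebra_isAlgebra.Build F tensor_alg (@malg_scalerAr F word).
HB.instance Definition _ := GRing.Lmodule.on tensor_sq.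

Definition tgen (i : 'I_n) : tensor_alg := << fmu i >>.

Definition wdeg (w : seq 'I_n) : 'rV[int]_n := \sum_(i <- w) delta_mx 0 i.

Definition bichar (a b : 'rV[int]_n) : F :=
  \prod_i \prod_j p i j ^ (a 0 i * b 0 j).

Definition tens (f g : tensor_alg) : tensor_sq :=
  linext (fun u : word => linext (fun v : word => << (u, v) >> : tensor_sq) g) f.

(* C(u (x) v) = chi(deg u, deg v) v (x) u *)
Definition braid : tensor_sq -> tensor_sq :=
  linext (fun uv : word * word =>
    bichar (wdeg uv.1) (wdeg uv.2) *: << (uv.2, uv.1) >> : tensor_sq).

(* (a (x) b)(c (x) d) = a C(b (x) c) d *)
Definition tsq_mul (s t : tensor_sq) : tensor_sq :=
  linext (fun ab : word * word => linext (fun cd : word * word =>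
    bichar (wdeg ab.2) (wdeg cd.1) *: << (mmul ab.1 cd.1, mmul ab.2 cd.2) >>
      : tensor_sq) t) s.

(* The algebra map T(V) -> T(V) (x) T(V) for which the x_i are primitive. *)
Definition coprod_word (w : seq 'I_n) : tensor_sq :=
  foldr (fun i => tsq_mul (tens (tgen i) 1 + tens 1 (tgen i))) (tens 1 1) w.

Definition coprod : tensor_alg -> tensor_sq := linext (fun w : word => coprod_word w).

Definition counit (f : tensor_alg) : F := mcoeff mone f.

(* S(x_i) = - x_i and S(a b) = chi(deg a, deg b) S(b) S(a) *)
Fixpoint antipode_word (w : seq 'I_n) : tensor_alg :=
  if w is i :: w' then
    - (bichar (wdeg [:: i]) (wdeg w') *: (antipode_word w' * tgen i))
  else 1.

Definition antipode : tensor_alg -> tensor_alg := linext (fun w : word => antipode_word w).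

(* I (x) T(V) + T(V) (x) I *)
Definition ideal_tens (I : tensor_alg -> Prop) : tensor_sq -> Prop :=
  span (fun t => exists f g, (I f \/ I g) /\ t = tens f g).

Record braided_hopf_ideal (I : tensor_alg -> Prop) : Prop := BraidedHopfIdeal {
  bhi_subspace : is_subspace I;
  bhi_mull : forall f g, I g -> I (f * g);
  bhi_mulr : forall f g, I f -> I (f * g);
  bhi_coprod : forall f, I f -> ideal_tens I (coprod f);
  bhi_counit : forall f, I f -> counit f = 0;
  bhi_antipode : forall f, I f -> I (antipode f);
  bhi_braid : forall t, ideal_tens I (braid t) <-> ideal_tens I t
}.

Definition deg_ge2 (f : tensor_alg) : Prop :=
  forall w : word, w \in msupp f -> (2 <= size w)%N.

(* The sum of all braided Hopf ideals contained in the part of degree >= 2. By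
   [nichols_ideal_bhi], [nichols_ideal_ge2] and [nichols_ideal_max] below, it is
   the largest of them. *)
Definition nichols_ideal : tensor_alg -> Prop :=
  span (fun f => exists I : tensor_alg -> Prop,
    [/\ braided_hopf_ideal I, forall g, I g -> deg_ge2 g & I f]).

Local Notation J := nichols_ideal.

Lemma nichols_ideal_max (I : tensor_alg -> Prop) : braided_hopf_ideal I ->
  (forall g, I g -> deg_ge2 g) -> forall f, I f -> J f.
Proof. by move=> hI I2 f If; apply: span_in; exists I. Qed.

Lemma nichols_ideal_ge2 f : J f -> deg_ge2 f.
Proof.
apply=> [|g [I [_ I2 /I2 //]]]; split=> [w|a x y hx hy w].
  by rewrite msupp0 inE.
move/(fsubsetP (msuppD_le _ _)); rewrite in_fsetU => /orP[|/hy //].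
by move/(fsubsetP (msuppZ_le _ _)) => /hx.
Qed.

Lemma mulr_linl (g : tensor_alg) : linear (fun f : tensor_alg => f * g).
Proof. by move=> a x y; rewrite mulrDl scalerAl. Qed.

Lemma mulr_linr (g : tensor_alg) : linear (fun f : tensor_alg => g * f).
Proof. by move=> a x y; rewrite mulrDr malg_scalerAr. Qed.

Lemma nichols_ideal_subspace : is_subspace J.
Proof. exact: span_subspace. Qed.

Lemma nichols_ideal_mull f g : J g -> J (f * g).
Proof.
move=> Jg; apply: (Jg (fun g => J (f * g))).
  exact: subspace_preim (@mulr_linr f) nichols_ideal_subspace.
move=> h [I [hI I2 Ih]]; apply: (nichols_ideal_max hI I2).
exact: bhi_mull.
Qed.

Lemma nichols_ideal_mulr f g : J f -> J (f * g).
Proof.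
move=> Jf; apply: (Jf (fun f => J (f * g))).
  exact: subspace_preim (@mulr_linl g) nichols_ideal_subspace.
move=> h [I [hI I2 Ih]]; apply: (nichols_ideal_max hI I2).
exact: bhi_mulr.
Qed.

Definition nichols_pred : {pred tensor_alg} := fun f => `[< J f >].

Lemma nichols_predE f : (f \in nichols_pred) = `[< J f >].
Proof. by []. Qed.

Lemma nichols_zmod_closed : zmod_closed nichols_pred.
Proof.
split=> [|f g]; rewrite !nichols_predE.
  by apply/asboolP; have [] := nichols_ideal_subspace.
move=> /asboolP Jf /asboolP Jg; apply/asboolP; rewrite addrC -scaleN1r.
by have [_] := nichols_ideal_subspace; apply.
Qed.

HB.instance Definition _ :=
  GRing.isZmodClosed.Build tensor_alg nichols_pred nichols_zmod_closed.

Definition nichols_alg := Quotient.quot nichols_pred.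

Local Notation B := nichols_alg.
Local Notation pi := (\pi_B : tensor_alg -> B).

HB.instance Definition _ := GRing.Zmodule.on B.

Lemma eq_piP (f g : tensor_alg) : pi f = pi g :> B <-> J (f - g).
Proof.
split=> [E|Jfg]; first by apply/asboolP; rewrite -nichols_predE Quotient.idealrBE E.
by apply/eqP; rewrite -Quotient.idealrBE nichols_predE; apply/asboolP.
Qed.

Lemma pi_reprB (f : tensor_alg) : J (repr (pi f : B) - f).
Proof. by apply/eq_piP; rewrite reprK. Qed.

Lemma piD (f g : tensor_alg) : pi (f + g) = pi f + pi g :> B.
Proof. by rewrite !piE. Qed.

Definition nichols_one : B := lift_cst B 1.
Definition nichols_mul : B -> B -> B := lift_op2 B *%R.
Definition nichols_scale (a : F) : B -> B := lift_op1 B ( *:%R a).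

Lemma pi_one : pi 1 = nichols_one.
Proof. by rewrite /nichols_one; unlock. Qed.

Lemma pi_mul f g : nichols_mul (pi f) (pi g) = pi (f * g).
Proof.
unlock nichols_mul; apply/eq_piP; set f' := repr _; set g' := repr _.
have -> : f' * g' - f * g = f' * (g' - g) + (f' - f) * g.
  by rewrite mulrBr mulrBl addrA subrK.
apply: (subspaceD nichols_ideal_subspace).
  by apply: nichols_ideal_mull; apply: pi_reprB.
by apply: nichols_ideal_mulr; apply: pi_reprB.
Qed.

Lemma pi_scale a f : nichols_scale a (pi f) = pi (a *: f).
Proof.
unlock nichols_scale; apply/eq_piP; rewrite -scalerBr.
exact: subspaceZ nichols_ideal_subspace (pi_reprB f).
Qed.

Lemma nichols_mulA : associative nichols_mul.
Proof.
by move=> x y z; rewrite -[x]reprK -[y]reprK -[z]reprK !pi_mul mulrA.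
Qed.

Lemma nichols_mul1 : left_id nichols_one nichols_mul.
Proof. by move=> x; rewrite -[x]reprK -pi_one pi_mul mul1r. Qed.

Lemma nichols_mulr1 : right_id nichols_one nichols_mul.
Proof. by move=> x; rewrite -[x]reprK -pi_one pi_mul mulr1. Qed.

Lemma nichols_mulDl : left_distributive nichols_mul +%R.
Proof.
move=> x y z; rewrite -[x]reprK -[y]reprK -[z]reprK.
by rewrite -piD !pi_mul -piD mulrDl.
Qed.

Lemma nichols_mulDr : right_distributive nichols_mul +%R.
Proof.
move=> x y z; rewrite -[x]reprK -[y]reprK -[z]reprK.
by rewrite -piD !pi_mul -piD mulrDr.
Qed.

Lemma nichols_one_neq0 : nichols_one != 0.
Proof.
apply/eqP=> E; have /eq_piP : pi 1 = pi 0 :> B by rewrite pi_one E piE.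
rewrite subr0 => /nichols_ideal_ge2 /(_ mone).
by rewrite msuppU1 in_fset1 eqxx fm1 => /(_ isT).
Qed.

HB.instance Definition _ := GRing.Zmodule_isNzRing.Build B
  nichols_mulA nichols_mul1 nichols_mulr1 nichols_mulDl nichols_mulDr
  nichols_one_neq0.

Lemma nichols_scaleA a b x :
  nichols_scale a (nichols_scale b x) = nichols_scale (a * b) x.
Proof. by rewrite -[x]reprK !pi_scale scalerA. Qed.

Lemma nichols_scale1 : left_id 1 nichols_scale.
Proof. by move=> x; rewrite -[x]reprK pi_scale scale1r. Qed.

Lemma nichols_scaleDr : right_distributive nichols_scale +%R.
Proof.
move=> a x y; rewrite -[x]reprK -[y]reprK.
by rewrite -piD !pi_scale -piD scalerDr.
Qed.

Lemma nichols_scaleDl x : {morph nichols_scale^~ x : a b / a + b}.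
Proof. by move=> a b; rewrite -[x]reprK !pi_scale -piD scalerDl. Qed.

HB.instance Definition _ := GRing.Zmodule_isLmodule.Build F B
  nichols_scaleA nichols_scale1 nichols_scaleDr nichols_scaleDl.

Lemma piM (f g : tensor_alg) : pi (f * g) = pi f * pi g :> B.
Proof. by rewrite -[RHS]/(nichols_mul _ _) pi_mul. Qed.

Lemma piZ a (f : tensor_alg) : pi (a *: f) = a *: pi f :> B.
Proof. by rewrite -[RHS]/(nichols_scale _ _) pi_scale. Qed.

Lemma pi_linear : linear (\pi : tensor_alg -> B).
Proof. by move=> a f g; rewrite piD piZ. Qed.

Lemma nichols_scaleAl a (x y : B) : a *: (x * y) = a *: x * y.
Proof.
by rewrite -[x]reprK -[y]reprK -piM -!piZ -piM scalerAl.
Qed.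

HB.instance Definition _ := GRing.Lmodule_isLalgebra.Build F B nichols_scaleAl.

Lemma nichols_scaleAr a (x y : B) : a *: (x * y) = x * (a *: y).
Proof.
by rewrite -[x]reprK -[y]reprK -piM -!piZ -piM scalerAr.
Qed.

HB.instance Definition _ := GRing.Lalgebra_isAlgebra.Build F B nichols_scaleAr.

(* On words [u, v] = v u - chi(deg v, deg u) u v. *)
Definition tbracket (f g : tensor_alg) : tensor_alg :=
  linext (fun u : word => linext (fun v : word =>
    << mmul v u >> - bichar (wdeg v) (wdeg u) *: << mmul u v >>
      : tensor_alg) g) f.

(* Independent of the representatives by [pi_bracket], bilinear by [bracket_linl]
   and [bracket_linr], and equal to y x - chi(deg y, deg x) x y on homogeneous
   elements by [bracket_homogE]. *)
Definition bracket (x y : B) : B := pi (tbracket (repr x) (repr y)).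

Definition nichols_homog (a : 'rV[int]_n) (x : B) : Prop :=
  exists2 f : tensor_alg,
    (forall w : word, w \in msupp f -> wdeg w = a) & x = pi f.

Definition ngen (i : 'I_n) : B := pi (tgen i).

Definition nichols_lie (x : B) : Prop :=
  forall W : B -> Prop, is_subspace W -> (forall i, W (ngen i)) ->
    (forall y z, W y -> W z -> W (bracket y z)) -> W x.

Definition nmon (w : seq 'I_n) : B := \prod_(i <- w) ngen i.

Section NicholsTheory.

Hypothesis p_neq0 : forall i j, p i j != 0.

Lemma wdeg_cat (u v : seq 'I_n) : wdeg (u ++ v) = wdeg u + wdeg v.
Proof. exact: big_cat. Qed.

Lemma wdegM (u v : word) : wdeg (mmul u v) = wdeg u + wdeg v.
Proof. by rewrite fmM wdeg_cat. Qed.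

Lemma bichar_neq0 a b : bichar a b != 0.
Proof.
by apply/prodf_neq0 => i _; apply/prodf_neq0 => j _; apply: expfz_neq0.
Qed.

Lemma bicharDl a b c : bichar (a + b) c = bichar a c * bichar b c.
Proof.
rewrite -big_split; apply: eq_bigr => i _; rewrite -big_split.
by apply: eq_bigr => j _; rewrite !mxE mulrDl expfzDr.
Qed.

Lemma bicharDr a b c : bichar a (b + c) = bichar a b * bichar a c.
Proof.
rewrite -big_split; apply: eq_bigr => i _; rewrite -big_split.
by apply: eq_bigr => j _; rewrite !mxE mulrDr expfzDr.
Qed.

Lemma bichar_delta i j : bichar (delta_mx 0 i) (delta_mx 0 j) = p i j.
Proof.
rewrite /bichar (bigD1 i) //= [X in _ * X]big1 => [|k /negPf ki]; last first.
  by rewrite big1 // => l _; rewrite !mxE ki andbF mul0r expr0z.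
rewrite mulr1 (bigD1 j) //= big1 => [|k /negPf kj]; last first.
  by rewrite !mxE kj andbF mulr0 expr0z.
by rewrite mulr1 !mxE !eqxx.
Qed.

Lemma tensUU (u v : word) : tens << u >> << v >> = << (u, v) >>.
Proof. by rewrite /tens !linextU. Qed.

Lemma tens_linl g : linear (tens^~ g).
Proof. exact: linextP. Qed.

Lemma tens_linr f : linear (tens f).
Proof. by rewrite /tens; apply: linext_linr => u; apply: linextP. Qed.

Lemma ideal_tens_subspace I : is_subspace (ideal_tens I).
Proof. exact: span_subspace. Qed.

Lemma ideal_tensl (I : tensor_alg -> Prop) f g : I f -> ideal_tens I (tens f g).
Proof. by move=> If; apply: span_in; exists f, g; split; [left|]. Qed.

Lemma ideal_tensr (I : tensor_alg -> Prop) f g : I g -> ideal_tens I (tens f g).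
Proof. by move=> Ig; apply: span_in; exists f, g; split; [right|]. Qed.

Lemma ideal_tens_ind (I : tensor_alg -> Prop) (W : tensor_sq -> Prop) :
  is_subspace W ->
  (forall f (v : word), I f -> W (tens f << v >>)) ->
  (forall f (v : word), I f -> W (tens << v >> f)) ->
  forall t, ideal_tens I t -> W t.
Proof.
move=> sW Wl Wr t; apply=> // _ [f [g [[If|Ig] ->]]].
  move: g; apply: malg_subspace => [|v]; last exact: Wl.
  exact: subspace_preim (tens_linr f) sW.
move: f; apply: malg_subspace => [|v]; last exact: Wr.
exact: subspace_preim (tens_linl g) sW.
Qed.

Lemma ideal_tens_mono (I I' : tensor_alg -> Prop) : (forall f, I f -> I' f) ->
  forall t, ideal_tens I t -> ideal_tens I' t.
Proof.
move=> II'; apply: ideal_tens_ind => [|f v If|f v If].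
- exact: ideal_tens_subspace.
- by apply: ideal_tensl; apply: II'.
- by apply: ideal_tensr; apply: II'.
Qed.

Definition braid_inv : tensor_sq -> tensor_sq :=
  linext (fun uv : word * word =>
    (bichar (wdeg uv.2) (wdeg uv.1))^-1 *: << (uv.2, uv.1) >> : tensor_sq).

Lemma braidU (u v : word) :
  braid << (u, v) >> = bichar (wdeg u) (wdeg v) *: << (v, u) >>.
Proof. exact: linextU. Qed.

Lemma braid_invU (u v : word) :
  braid_inv << (u, v) >> = (bichar (wdeg v) (wdeg u))^-1 *: << (v, u) >>.
Proof. exact: linextU. Qed.

Lemma braid_lin : linear braid. Proof. exact: linextP. Qed.
Lemma braid_inv_lin : linear braid_inv. Proof. exact: linextP. Qed.

Lemma lin0 (U V : lmodType F) (phi : U -> V) : linear phi -> phi 0 = 0.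
Proof.
by move=> lphi; have := lphi (-1) 0 0; rewrite !scaleN1r oppr0 addr0 addNr.
Qed.

Lemma linZ (U V : lmodType F) (phi : U -> V) a x :
  linear phi -> phi (a *: x) = a *: phi x.
Proof. by move=> lphi; rewrite -[a *: x]addr0 lphi (lin0 lphi) addr0. Qed.

Lemma lin_sum (U V : lmodType F) (phi : U -> V) (I : Type) (r : seq I) (G : I -> U) :
  linear phi -> phi (\sum_(i <- r) G i) = \sum_(i <- r) phi (G i).
Proof.
move=> lphi; elim: r => [|i r IHr]; first by rewrite !big_nil (lin0 lphi).
by rewrite !big_cons -IHr -[G i]scale1r lphi !scale1r.
Qed.

Lemma linB (U V : lmodType F) (phi : U -> V) x y :
  linear phi -> phi (x - y) = phi x - phi y.
Proof. by move=> lphi; rewrite addrC -scaleN1r lphi scaleN1r addrC. Qed.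

Lemma linear_comp (U V W : lmodType F) (psi : V -> W) (phi : U -> V) :
  linear psi -> linear phi -> linear (fun x => psi (phi x)).
Proof. by move=> lpsi lphi a x y; rewrite lphi lpsi. Qed.

Lemma linear_scale (U V : lmodType F) a (phi : U -> V) :
  linear phi -> linear (fun x => a *: phi x).
Proof. by move=> lphi b x y; rewrite lphi scalerDr !scalerA mulrC. Qed.

Lemma linear_add (U V : lmodType F) (phi psi : U -> V) :
  linear phi -> linear psi -> linear (fun x => phi x + psi x).
Proof.
by move=> lphi lpsi b x y; rewrite lphi lpsi scalerDr addrACA.
Qed.

Lemma braidK : cancel braid braid_inv.
Proof.
apply: linear_eq => [||[u v]] //.
  exact: linear_comp braid_inv_lin braid_lin.
rewrite braidU (linZ _ _ braid_inv_lin) braid_invU scalerA.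
by rewrite divff ?scale1r ?bichar_neq0.
Qed.

Lemma braid_invK : cancel braid_inv braid.
Proof.
apply: linear_eq => [||[u v]] //.
  exact: linear_comp braid_lin braid_inv_lin.
rewrite braid_invU (linZ _ _ braid_lin) braidU scalerA.
by rewrite mulVf ?scale1r ?bichar_neq0.
Qed.

Lemma braid_iff (K : tensor_sq -> Prop) :
  (forall t, K t -> K (braid t)) -> (forall t, K t -> K (braid_inv t)) ->
  forall t, K (braid t) <-> K t.
Proof. by move=> K1 K2 t; split=> [/K2|/K1 //]; rewrite braidK. Qed.

Lemma nichols_ideal_bhi : braided_hopf_ideal J.
Proof.
have J_ind (W : tensor_alg -> Prop) : is_subspace W ->
    (forall I, braided_hopf_ideal I -> (forall f, I f -> J f) ->
       forall f, I f -> W f) -> forall f, J f -> W f.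
  move=> sW WI f; apply=> // g [I [hI I2 Ig]].
  by apply: WI Ig => //; apply: nichols_ideal_max.
split.
- exact: nichols_ideal_subspace.
- exact: nichols_ideal_mull.
- exact: nichols_ideal_mulr.
- apply: J_ind => [|I hI IJ f If].
    exact: subspace_preim (linextP _) (ideal_tens_subspace J).
  by apply: (ideal_tens_mono IJ); apply: bhi_coprod.
- apply: J_ind => [|I hI _ f If]; last exact: bhi_counit hI _ If.
  split=> [|a f g Ef Eg]; rewrite /counit ?mcoeff0 // mcoeffD mcoeffZ.
  by move: Ef Eg; rewrite /counit => -> ->; rewrite mulr0 addr0.
- apply: J_ind => [|I hI IJ f If].
    exact: subspace_preim (linextP _) nichols_ideal_subspace.
  by apply: IJ; apply: bhi_antipode.
- have KJ := ideal_tens_subspace J.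
  have lb (psi : tensor_sq -> tensor_sq) : linear psi ->
      (forall I, braided_hopf_ideal I -> forall t, ideal_tens I t ->
         ideal_tens I (psi t)) ->
      forall t, ideal_tens J t -> ideal_tens J (psi t).
    move=> lpsi hpsi; apply: ideal_tens_ind => [|f v|f v].
    + exact: subspace_preim lpsi KJ.
    + move: f; apply: J_ind => [|I hI IJ f If].
        exact: subspace_preim (linear_comp lpsi (tens_linl _)) KJ.
      by apply: (ideal_tens_mono IJ); apply: hpsi => //; apply: ideal_tensl.
    + move: f; apply: J_ind => [|I hI IJ f If].
        exact: subspace_preim (linear_comp lpsi (tens_linr _)) KJ.
      by apply: (ideal_tens_mono IJ); apply: hpsi => //; apply: ideal_tensr.
  apply: braid_iff; apply: lb.
  + exact: braid_lin.
  + by move=> I hI t; rewrite bhi_braid.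
  + exact: braid_inv_lin.
  + by move=> I hI t It; rewrite -(bhi_braid hI) braid_invK.
Qed.

Section Components.
Variables (K : choiceType) (d : K -> 'rV[int]_n).

Definition hcomp (a : 'rV[int]_n) : {malg F[K]} -> {malg F[K]} :=
  linext (fun k => if d k == a then << k >> else 0).

Lemma hcompU a k : hcomp a << k >> = if d k == a then << k >> else 0.
Proof. exact: linextU. Qed.

Lemma hcomp_lin a : linear (hcomp a). Proof. exact: linextP. Qed.

Lemma hcompE a f k : (hcomp a f)@_k = if d k == a then f@_k else 0.
Proof.
move: f; apply: malg_subspace => [|l].
  split=> [|b f g Ef Eg]; first by rewrite (lin0 (hcomp_lin a)) !mcoeff0 if_same.
  rewrite hcomp_lin !mcoeffD !mcoeffZ Ef Eg.
  by case: ifP => // _; rewrite mulr0 addr0.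
rewrite hcompU; case: (eqVneq l k) => [->|lk].
  by case: ifP; rewrite ?mcoeff0.
by do 2!case: ifP; rewrite ?mcoeff0 // mcoeffU (negPf lk) mulr0n.
Qed.

Lemma msupp_hcomp a f k : k \in msupp (hcomp a f) -> (d k == a) && (k \in msupp f).
Proof. by rewrite -!mcoeff_neq0 hcompE; case: ifP; rewrite // eqxx. Qed.

Definition hom (a : 'rV[int]_n) : {malg F[K]} -> Prop :=
  span (fun t => exists k, d k = a /\ t = << k >>).

Lemma hom_subspace a : is_subspace (hom a). Proof. exact: span_subspace. Qed.

Lemma hom_in a k : d k = a -> hom a << k >>.
Proof. by move=> dk; apply: span_in; exists k. Qed.

Lemma homP a t : hom a t -> forall b, hcomp b t = if a == b then t else 0.
Proof.
move=> ht b; apply: (ht (fun t => hcomp b t = if a == b then t else 0)) => [|_ [k [<- ->]]]; last by rewrite hcompU.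
split=> [|c x y Ex Ey]; first by rewrite (lin0 (hcomp_lin b)) if_same.
by rewrite hcomp_lin Ex Ey; case: ifP => // _; rewrite scaler0 addr0.
Qed.

Lemma hom_sum f : f = \sum_(a <- undup [seq d k | k <- msupp f]) hcomp a f.
Proof.
apply/malgP=> k; rewrite raddf_sum /=.
under eq_bigr do rewrite hcompE.
case: (msuppP f k) => [kf|_]; last by rewrite big1 // => a _; rewrite if_same.
rewrite (bigD1_seq (d k)) ?undup_uniq ?mem_undup ?map_f //= eqxx.
by rewrite big1 ?addr0 // => a; rewrite eq_sym => /negPf ->.
Qed.

End Components.

Lemma malgMUU (u v : word) : << u >> * << v >> = << mmul u v >> :> tensor_alg.
Proof. by rewrite malgM_def fgmulUU mulr1. Qed.

Local Notation wcomp := (hcomp (fun w : word => wdeg w)).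
Local Notation tdeg := (fun uv : word * word => wdeg uv.1 + wdeg uv.2).
Local Notation tcomp := (hcomp tdeg).
Local Notation whom := (hom (fun w : word => wdeg w)).
Local Notation thom := (hom tdeg).

Lemma hcompMl a (u : word) f :
  << u >> * wcomp a f = wcomp (wdeg u + a) (<< u >> * f) :> tensor_alg.
Proof.
move: f; apply: linear_eq => [||w].
- exact: linear_comp (@mulr_linr _) (@hcomp_lin _ _ a).
- exact: linear_comp (@hcomp_lin _ _ _) (@mulr_linr _).
- rewrite malgMUU !hcompU wdegM (inj_eq (addrI _)).
  by case: ifP; rewrite ?mulr0 ?malgMUU.
Qed.

Lemma hcompMr a (u : word) f :
  wcomp a f * << u >> = wcomp (a + wdeg u) (f * << u >>) :> tensor_alg.
Proof.
move: f; apply: linear_eq => [||w].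
- exact: linear_comp (@mulr_linl _) (@hcomp_lin _ _ a).
- exact: linear_comp (@hcomp_lin _ _ _) (@mulr_linl _).
- rewrite malgMUU !hcompU wdegM (inj_eq (addIr _)).
  by case: ifP; rewrite ?mul0r ?malgMUU.
Qed.

Lemma tcomp_tensl a f (v : word) :
  tcomp a (tens f << v >>) = tens (wcomp (a - wdeg v) f) << v >>.
Proof.
move: f; apply: linear_eq => [||w].
- exact: linear_comp (@hcomp_lin _ _ _) (tens_linl _).
- exact: linear_comp (tens_linl _) (@hcomp_lin _ _ _).
- rewrite tensUU !hcompU eq_sym -subr_eq eq_sym /=.
  by case: ifP; rewrite ?(lin0 (tens_linl _)) ?tensUU.
Qed.

Lemma tcomp_tensr a f (v : word) :
  tcomp a (tens << v >> f) = tens << v >> (wcomp (a - wdeg v) f).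
Proof.
move: f; apply: linear_eq => [||w].
- exact: linear_comp (@hcomp_lin _ _ _) (tens_linr _).
- exact: linear_comp (tens_linr _) (@hcomp_lin _ _ _).
- rewrite tensUU !hcompU eq_sym addrC -subr_eq eq_sym /=.
  by case: ifP; rewrite ?(lin0 (tens_linr _)) ?tensUU.
Qed.

Lemma tsq_mul_linl t : linear (tsq_mul^~ t).
Proof. exact: linextP. Qed.

Lemma tsq_mul_linr s : linear (tsq_mul s).
Proof. by rewrite /tsq_mul; apply: linext_linr => u; apply: linextP. Qed.

Lemma thomM a b s t : thom a s -> thom b t -> thom (a + b) (tsq_mul s t).
Proof.
move=> hs ht; apply: (hs (fun s => thom (a + b) (tsq_mul s t))).
  exact: subspace_preim (tsq_mul_linl t) (hom_subspace _ _).
move=> _ [[u v] [<- ->]]; apply: (ht (fun t => thom (_ + b) (tsq_mul _ t))).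
  exact: subspace_preim (tsq_mul_linr _) (hom_subspace _ _).
move=> _ [[u' v'] [<- ->]]; rewrite /tsq_mul !linextU /=.
apply: subspaceZ (hom_subspace _ _) _.
by apply: hom_in; rewrite /= !wdegM addrACA.
Qed.

Lemma wdeg_nil : wdeg [::] = 0. Proof. exact: big_nil. Qed.
Lemma wdeg_one : wdeg (mone : word) = 0. Proof. by rewrite fm1 wdeg_nil. Qed.

Lemma wdeg_cons i w : wdeg (i :: w) = wdeg (fmu i) + wdeg w.
Proof. by rewrite fmuE -wdeg_cat. Qed.

Lemma coprod_word_hom w : thom (wdeg w) (coprod_word w).
Proof.
elim: w => [|i w IHw] /=.
  by rewrite tensUU; apply: hom_in; rewrite /= wdeg_one wdeg_nil addr0.
rewrite wdeg_cons; apply: thomM => //; rewrite !tensUU.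
apply: subspaceD (hom_subspace _ _) _ _.
  by apply: hom_in; rewrite /= wdeg_one addr0.
by apply: hom_in; rewrite /= wdeg_one add0r.
Qed.

Lemma coprod_hcomp a f : coprod (wcomp a f) = tcomp a (coprod f).
Proof.
move: f; apply: linear_eq => [||w].
- exact: linear_comp (linextP _) (@hcomp_lin _ _ _).
- exact: linear_comp (@hcomp_lin _ _ _) (linextP _).
- rewrite hcompU /coprod linextU (homP (@coprod_word_hom w)).
  by case: ifP; rewrite ?linextU // (lin0 (linextP _)).
Qed.

Lemma antipode_word_hom w : whom (wdeg w) (antipode_word w).
Proof.
elim: w => [|i w IHw] /=.
  by apply: hom_in; rewrite wdeg_one wdeg_nil.
rewrite wdeg_cons -scaleN1r scalerA; apply: subspaceZ (hom_subspace _ _) _.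
apply: (IHw (fun f => whom (_ + wdeg w) (f * tgen i))).
  exact: subspace_preim (@mulr_linl _) (hom_subspace _ _).
move=> _ [u [<- ->]]; rewrite malgMUU.
by apply: hom_in; rewrite wdegM addrC.
Qed.

Lemma antipode_hcomp a f : antipode (wcomp a f) = wcomp a (antipode f).
Proof.
move: f; apply: linear_eq => [||w].
- exact: linear_comp (linextP _) (@hcomp_lin _ _ _).
- exact: linear_comp (@hcomp_lin _ _ _) (linextP _).
- rewrite hcompU /antipode linextU (homP (@antipode_word_hom w)).
  by case: ifP; rewrite ?linextU // (lin0 (linextP _)).
Qed.

Lemma braid_hcompl a f (v : word) : braid (tens (wcomp a f) << v >>) =
  bichar a (wdeg v) *: tens << v >> (wcomp a f).
Proof.
move: f; apply: linear_eq => [||w].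
- exact: linear_comp braid_lin (linear_comp (tens_linl _) (@hcomp_lin _ _ _)).
- exact: linear_scale (linear_comp (tens_linr _) (@hcomp_lin _ _ _)).
- rewrite hcompU; case: eqP => [<-|_]; first by rewrite !tensUU braidU.
  by rewrite (lin0 (tens_linl _)) (lin0 (tens_linr _)) (lin0 braid_lin) scaler0.
Qed.

Lemma braid_hcompr a f (v : word) : braid (tens << v >> (wcomp a f)) =
  bichar (wdeg v) a *: tens (wcomp a f) << v >>.
Proof.
move: f; apply: linear_eq => [||w].
- exact: linear_comp braid_lin (linear_comp (tens_linr _) (@hcomp_lin _ _ _)).
- exact: linear_scale (linear_comp (tens_linl _) (@hcomp_lin _ _ _)).
- rewrite hcompU; case: eqP => [<-|_]; first by rewrite !tensUU braidU.
  by rewrite (lin0 (tens_linl _)) (lin0 (tens_linr _)) (lin0 braid_lin) scaler0.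
Qed.

Lemma nichols_ideal_homog a f : J f -> J (wcomp a f).
Proof.
pose H := span (fun f => exists a g, J g /\ f = wcomp a g).
have sH : is_subspace H by exact: span_subspace.
have Hc b g : J g -> H (wcomp b g) by move=> Jg; apply: span_in; exists b, g.
have H_ind (W : tensor_alg -> Prop) : is_subspace W ->
    (forall b g, J g -> W (wcomp b g)) -> forall g, H g -> W g.
  by move=> sW WJ g; apply=> // _ [b [h [Jh ->]]]; apply: WJ.
have sK := ideal_tens_subspace H.
have [sJ Jl Jr Jc Je Ja Jb] := nichols_ideal_bhi.
move=> Jf; apply: nichols_ideal_max (Hc a f Jf); last first.
  apply: H_ind => [|b g Jg w /msupp_hcomp/andP[_]]; last exact: nichols_ideal_ge2.
  split=> [w|c x y hx hy w]; first by rewrite msupp0 inE.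
  move/(fsubsetP (msuppD_le _ _)); rewrite in_fsetU => /orP[|/hy //].
  by move/(fsubsetP (msuppZ_le _ _)) => /hx.
split=> //.
- move=> g h Hh; move: g; apply: malg_subspace => [|u].
    exact: subspace_preim (@mulr_linl h) sH.
  move: h Hh; apply: H_ind => [|b h Jh].
    exact: subspace_preim (@mulr_linr _) sH.
  by rewrite hcompMl; apply: Hc; apply: Jl.
- move=> h g Hh; move: g; apply: malg_subspace => [|u].
    exact: subspace_preim (@mulr_linr h) sH.
  move: h Hh; apply: H_ind => [|b h Jh].
    exact: subspace_preim (@mulr_linl _) sH.
  by rewrite hcompMr; apply: Hc; apply: Jr.
- apply: H_ind => [|b g Jg]; first exact: subspace_preim (linextP _) sK.
  rewrite coprod_hcomp; move: (Jc _ Jg).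
  move: (coprod g); apply: ideal_tens_ind => [|h v Jh|h v Jh].
  + exact: subspace_preim (@hcomp_lin _ _ _) sK.
  + by rewrite tcomp_tensl; apply: ideal_tensl; apply: Hc.
  + by rewrite tcomp_tensr; apply: ideal_tensr; apply: Hc.
- apply: H_ind => [|b g Jg].
    split=> [|c g h Eg Eh]; rewrite /counit ?mcoeff0 // mcoeffD mcoeffZ.
    by move: Eg Eh; rewrite /counit => -> ->; rewrite mulr0 addr0.
  rewrite /counit hcompE; case: ifP => // _; exact: Je.
- apply: H_ind => [|b g Jg]; first exact: subspace_preim (linextP _) sH.
  by rewrite antipode_hcomp; apply: Hc; apply: Ja.
- apply: braid_iff; apply: ideal_tens_ind => [|h v Hh|h v Hh].
  + exact: subspace_preim braid_lin sK.
  + move: h Hh; apply: H_ind => [|b h Jh].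
      exact: subspace_preim (linear_comp braid_lin (tens_linl _)) sK.
    by rewrite braid_hcompl; apply: subspaceZ sK _; apply: ideal_tensr; apply: Hc.
  + move: h Hh; apply: H_ind => [|b h Jh].
      exact: subspace_preim (linear_comp braid_lin (tens_linr _)) sK.
    by rewrite braid_hcompr; apply: subspaceZ sK _; apply: ideal_tensl; apply: Hc.
  + exact: subspace_preim braid_inv_lin sK.
  + move: h Hh; apply: H_ind => [|b h Jh].
      exact: subspace_preim (linear_comp braid_inv_lin (tens_linl _)) sK.
    have -> : tens (wcomp b h) << v >> =
        braid ((bichar (wdeg v) b)^-1 *: tens << v >> (wcomp b h)).
      by rewrite (linZ _ _ braid_lin) braid_hcompr scalerA mulVf ?scale1r ?bichar_neq0.
    by rewrite braidK; apply: subspaceZ sK _; apply: ideal_tensr; apply: Hc.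
  + move: h Hh; apply: H_ind => [|b h Jh].
      exact: subspace_preim (linear_comp braid_inv_lin (tens_linr _)) sK.
    have -> : tens << v >> (wcomp b h) =
        braid ((bichar b (wdeg v))^-1 *: tens (wcomp b h) << v >>).
      by rewrite (linZ _ _ braid_lin) braid_hcompl scalerA mulVf ?scale1r ?bichar_neq0.
    by rewrite braidK; apply: subspaceZ sK _; apply: ideal_tensl; apply: Hc.
Qed.

Lemma tbracketUU (u v : word) : tbracket << u >> << v >> =
  << mmul v u >> - bichar (wdeg v) (wdeg u) *: << mmul u v >>.
Proof. by rewrite /tbracket !linextU. Qed.

Lemma tbracket_linl g : linear (tbracket^~ g).
Proof. exact: linextP. Qed.

Lemma tbracket_linr f : linear (tbracket f).
Proof. by rewrite /tbracket; apply: linext_linr => u; apply: linextP. Qed.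

Lemma tbracket_homog a b f g : tbracket (wcomp a f) (wcomp b g) =
  wcomp b g * wcomp a f - bichar b a *: (wcomp a f * wcomp b g).
Proof.
move: f; apply: linear_eq => [||u].
- exact: linear_comp (tbracket_linl _) (@hcomp_lin _ _ _).
- under eq_fun do rewrite -scaleNr.
  apply: linear_add; first exact: linear_comp (@mulr_linr _) (@hcomp_lin _ _ _).
  exact: linear_scale (linear_comp (@mulr_linl _) (@hcomp_lin _ _ _)).
move: g; apply: linear_eq => [||v].
- exact: linear_comp (tbracket_linr _) (@hcomp_lin _ _ _).
- under eq_fun do rewrite -scaleNr.
  apply: linear_add; first exact: linear_comp (@mulr_linl _) (@hcomp_lin _ _ _).
  exact: linear_scale (linear_comp (@mulr_linr _) (@hcomp_lin _ _ _)).
rewrite !hcompU; case: eqP => [<-|_]; last first.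
  by rewrite (lin0 (tbracket_linl _)) mulr0 mul0r scaler0 subr0.
case: eqP => [<-|_]; last first.
  by rewrite (lin0 (tbracket_linr _)) mulr0 mul0r scaler0 subr0.
by rewrite tbracketUU !malgMUU.
Qed.

Lemma hcompUU (v : word) : wcomp (wdeg v) << v >> = << v >>.
Proof. by rewrite hcompU eqxx. Qed.

Lemma nichols_ideal_tbracketl f g : J f -> J (tbracket f g).
Proof.
move=> Jf; move: g; apply: malg_subspace => [|v].
  exact: subspace_preim (tbracket_linr f) nichols_ideal_subspace.
have -> : tbracket f << v >> =
    \sum_(a <- undup [seq wdeg w | w : word <- msupp f]) tbracket (wcomp a f) << v >>.
  rewrite {1}[f](hom_sum (fun w : word => wdeg w)).
  exact: (lin_sum _ _ (tbracket_linl _)).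
apply: (subspace_sum _ nichols_ideal_subspace) => a.
rewrite -hcompUU tbracket_homog hcompUU -scaleN1r scalerA addrC.
apply: (proj2 nichols_ideal_subspace).
  by apply: nichols_ideal_mulr; apply: nichols_ideal_homog.
by apply: nichols_ideal_mull; apply: nichols_ideal_homog.
Qed.

Lemma nichols_ideal_tbracketr f g : J g -> J (tbracket f g).
Proof.
move=> Jg; move: f; apply: malg_subspace => [|v].
  exact: subspace_preim (tbracket_linl g) nichols_ideal_subspace.
have -> : tbracket << v >> g =
    \sum_(a <- undup [seq wdeg w | w : word <- msupp g]) tbracket << v >> (wcomp a g).
  rewrite {1}[g](hom_sum (fun w : word => wdeg w)).
  exact: (lin_sum _ _ (tbracket_linr _)).
apply: (subspace_sum _ nichols_ideal_subspace) => a.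
rewrite -hcompUU tbracket_homog hcompUU -scaleN1r scalerA addrC.
apply: (proj2 nichols_ideal_subspace).
  by apply: nichols_ideal_mull; apply: nichols_ideal_homog.
by apply: nichols_ideal_mulr; apply: nichols_ideal_homog.
Qed.

Lemma pi_bracket f g : bracket (pi f) (pi g) = pi (tbracket f g).
Proof.
apply/eq_piP; set f' := repr _; set g' := repr _.
have -> : tbracket f' g' - tbracket f g =
    tbracket (f' - f) g' + tbracket f (g' - g).
  rewrite (linB _ _ (tbracket_linl g')) (linB _ _ (tbracket_linr f)).
  by rewrite addrA subrK.
apply: (subspaceD nichols_ideal_subspace).
  by apply: nichols_ideal_tbracketl; apply: pi_reprB.
by apply: nichols_ideal_tbracketr; apply: pi_reprB.
Qed.

Lemma bracket_linl y : linear (bracket^~ y).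
Proof.
move=> a x x'; rewrite -[x]reprK -[x']reprK -[y]reprK.
by rewrite -pi_linear !pi_bracket tbracket_linl pi_linear.
Qed.

Lemma bracket_linr x : linear (bracket x).
Proof.
move=> a y y'; rewrite -[x]reprK -[y]reprK -[y']reprK.
by rewrite -pi_linear !pi_bracket tbracket_linr pi_linear.
Qed.

Lemma pi_comm (u v : tensor_alg) c :
  pi (v * u - c *: (u * v)) = pi v * pi u - c *: (pi u * pi v).
Proof.
rewrite (linB (v * u) (c *: (u * v)) pi_linear) (piM v u).
by rewrite (linZ c (u * v) pi_linear) (piM u v).
Qed.

Lemma bracket_homogE a b x y : nichols_homog a x -> nichols_homog b y ->
  bracket x y = y * x - bichar b a *: (x * y).
Proof.
have hE c f : (forall w : word, w \in msupp f -> wdeg w = c) -> f = wcomp c f.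
  move=> hf; apply/malgP=> w; rewrite hcompE.
  case: ifP => // /negP wc; apply: mcoeff_outdom; apply/negP=> /hf/eqP //.
case=> f /hE -> -> [g /hE -> ->]; rewrite pi_bracket tbracket_homog.
exact: pi_comm.
Qed.

End NicholsTheory.

End TensorAlgebra.

Section Graphs.

Variables (T : finType) (e : rel T).

Definition induced (A : {set T}) : {set T} * {set T * T} :=
  (A, [set ij | [&& ij.1 \in A, ij.2 \in A & e ij.1 ij.2]]).

Definition is_component (G : {set T} * {set T * T}) : Prop :=
  exists i, G = induced [set j | connect e i j].

Definition is_connected : Prop := forall i j, connect e i j.

Definition is_maximal (P : {set T} -> Prop) (A : {set T}) : Prop :=
  P A /\ forall A', P A' -> A \subset A' -> A' = A.

End Graphs.

Section Dynkin.

Variables (F : fieldType) (n : nat) (p : 'M[F]_n).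

Definition dynkin : rel 'I_n := fun i j => (i != j) && (p i j * p j i != 1).

(* A monomial is given by a non-empty word w, and mu w is the set of the i such
   that x_i occurs in it. *)
Definition mu (w : seq 'I_n) : {set 'I_n} := [set i in w].

Definition word_graph (w : seq 'I_n) := induced dynkin (mu w).

Definition lie_support (A : {set 'I_n}) : Prop :=
  exists w, [/\ w != [::], nmon p w != 0, nichols_lie (nmon p w) & mu w = A].

End Dynkin.

(* Main.v *)
(* Everything reduces to: a non-zero monomial in L(V) has connected support, and
   conversely every multilinear monomial with connected support is non-zero and
   lies in L(V).

   If p_ij p_ji = 1, then x_i x_j - p_ij x_j x_i is primitive in T(V), hence
   vanishes in B(V), so monomials with disjoint, unlinked supports commute up to
   the scalar chi and have bracket 0.  Thus L(V) is spanned by monomials with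
   connected support, and homogeneity of the Nichols ideal gives the first claim.

   Multilinear monomials are non-zero since the skew derivations of T(V)
   preserve the Nichols ideal and strip off the letters one by one.  They lie in
   L(V), by induction on the length: modulo L(V) a connected factor u of a
   connected word uv can be moved to the end, uv = chi(u,v) vu.  Applying this
   to an edge xy, and to its letters one after the other, yields
   (p_xy p_yx - 1) vxy in L(V); up to rotations and commutations every connected
   word of length at least 2 starts with an edge. *)

Require Import Defs.
From mathcomp Require Import all_boot all_order all_algebra.
From mathcomp Require Import boolp finmap monalg.

Set Implicit Arguments.
Unset Strict Implicit.
Unset Printing Implicit Defensive.

Import GRing.Theory.
Local Open Scope ring_scope.
Local Open Scope quotient_scope.

(** * Connected vertex sets, described by cuts *)

Section CutConnected.

Variables (T : finType) (e : rel T).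
Hypothesis e_sym : symmetric e.
Implicit Types (A B C K : {set T}) (i j : T).

(** For [K] inside [A]: [K] is a union of connected components of the graph on [A]. *)
Definition cut_closed K A := forall i j, i \in K -> j \in A :\: K -> ~~ e i j.

(* Connectedness of the subgraph induced on a non-empty set of vertices,
   without reference to walks. *)
Definition conn A := A != set0 /\
  forall K, K \subset A -> K != set0 -> cut_closed K A -> K = A.

Lemma cut_closedC K A : cut_closed K A -> cut_closed (A :\: K) A.
Proof.
move=> cK i j iK; rewrite !inE negb_and negbK => /andP[/orP[jK|/negPf ->//] jA].
by rewrite e_sym; apply: cK.
Qed.

(** The set [A :&: K] is cut off inside [A] as well and contains [i], so connectedness makes it all
    of [A]. *)
Lemma conn_sub A B K i : conn A -> A \subset B -> cut_closed K B ->
  i \in A -> i \in K -> A \subset K.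
Proof.
move=> [_ cA] /subsetP AB cK iA iK; apply/setIidPl; apply: cA.
- exact: subsetIl.
- by apply/set0Pn; exists i; rewrite inE iA.
- move=> j k; rewrite inE => /andP[_ jK]; rewrite in_setD in_setI.
  move=> /andP[kK kA]; apply: cK => //; rewrite inE AB // andbT.
  by rewrite kA in kK.
Qed.

(** A cut-off set that meets [A] or [B] contains it by [conn_sub]; since no edge leaves it, it
    contains [i] and [j] together, and so passes from one of the two sets to the other. *)
Lemma connU A B i j : conn A -> conn B -> i \in A -> j \in B ->
  (i == j) || e i j -> conn (A :|: B).
Proof.
move=> cA cB iA jB ij; split; first by apply/set0Pn; exists i; rewrite inE iA.
move=> K /subsetP KAB /set0Pn[x xK] cK; apply/eqP; rewrite eqEsubset.
apply/andP; split; [exact/subsetP|].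
have ijK : (i \in K) = (j \in K).
  case/orP: ij => [/eqP -> //|ij]; apply/idP/idP => [iK|jK].
    apply: contraLR ij => jK; apply: (cK _ _ iK).
    by rewrite !inE jK jB orbT.
  apply: contraLR ij => iK; rewrite e_sym; apply: (cK _ _ jK).
  by rewrite !inE iK iA.
have iK : i \in K.
  have /setUP[xA|xB] := KAB x xK.
    by apply/(subsetP (conn_sub cA (subsetUl A B) cK xA xK)).
  by rewrite ijK; apply/(subsetP (conn_sub cB (subsetUr A B) cK xB xK)).
rewrite subUset (conn_sub cA (subsetUl A B) cK iA iK).
by rewrite (conn_sub cB (subsetUr A B) cK jB) // -ijK.
Qed.

Lemma conn1 i : conn [set i].
Proof.
split; first by apply/set0Pn; exists i; rewrite inE.
by move=> K; rewrite subset1 => /orP[/eqP -> //|/eqP ->]; rewrite eqxx.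
Qed.

Lemma conn_edge A K : conn A -> K \subset A -> K != set0 -> K != A ->
  exists i j, [/\ i \in K, j \in A :\: K & e i j].
Proof.
move=> [_ cA] KA K0 /eqP KnA; apply: contrapT => nE; apply: KnA.
apply: cA => // i j iK jK; apply/negP=> eij; apply: nE.
by exists i, j.
Qed.

Lemma closed_connect A i : cut_closed A setT -> i \in A ->
  [set j | connect e i j] \subset A.
Proof.
move=> cA iA; have clA : closed e (mem A).
  apply: intro_closed; first exact: sym_connect_sym.
  move=> x y xy xA; apply: contraLR xy => yA; apply: cA => //.
  by rewrite inE yA inE.
by apply/subsetP=> j; rewrite inE => /(closed_connect clA) <-.
Qed.

Lemma conn_connect i : conn [set j | connect e i j].
Proof.
split; first by apply/set0Pn; exists i; rewrite inE connect0.
move=> K /[dup] KC /subsetP KC' /set0Pn[x xK] cK.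
have ix : connect e i x by have := KC' x xK; rewrite inE.
(* Neighbours of [K] are reachable from [i], so [K] is closed in the whole graph as well. *)
have clK : cut_closed K setT.
  move=> y z yK; rewrite !inE andbT => zK; apply/negP=> yz.
  have := KC' y yK; rewrite inE => iy.
  suff : ~~ e y z by rewrite yz.
  by apply: cK; rewrite // !inE zK (connect_trans iy (connect1 yz)).
have sK := closed_connect clK xK.
apply/eqP; rewrite eqEsubset KC; apply/subsetP=> j; rewrite inE => ij.
apply: (subsetP sK); rewrite inE; apply: connect_trans ij.
by rewrite (sym_connect_sym e_sym).
Qed.

Lemma conn_sub_connect A i : conn A -> i \in A -> A \subset [set j | connect e i j].
Proof.
move=> cA iA; apply: (conn_sub cA (subsetT A)) iA _; last by rewrite inE connect0.
move=> x y; rewrite !inE andbT => ix; apply: contra => xy.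
exact: connect_trans ix (connect1 xy).
Qed.

Lemma is_connectedE : (0 < #|T|)%N -> is_connected e <-> conn setT.
Proof.
case/card_gt0P=> i0 _; split=> [cT|cT i j].
  suff -> : setT = [set j | connect e i0 j] by exact: conn_connect.
  by apply/setP=> j; rewrite !inE cT.
have := subsetP (conn_sub_connect cT (in_setT i)) j (in_setT j).
by rewrite inE.
Qed.

(** A class of [connect] is connected and contains every connected set through its base vertex. *)
Lemma componentE A : is_component e (induced e A) <-> is_maximal conn A.
Proof.
split=> [[i [-> _]]|[cA mA]].
  split; first exact: conn_connect.
  move=> B cB AB; apply/eqP; rewrite eqEsubset AB andbT.
  by apply: conn_sub_connect cB (subsetP AB i _); rewrite inE connect0.
have [/set0Pn[i iA] _] := cA; exists i; congr induced.
apply/esym/mA; [exact: conn_connect | exact: conn_sub_connect].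
Qed.

(** A minimal non-empty cut-closed part of [A] is connected: a set cut off inside it is cut off in
    [A] too. *)
Lemma conn_closed_part A : A != set0 ->
  exists C, [/\ C \subset A, conn C & cut_closed C A].
Proof.
case/set0Pn=> x xA.
have : `[< [/\ A \subset A, A != set0 & cut_closed A A] >].
  apply/asboolP; split; rewrite ?subxx //; first by apply/set0Pn; exists x.
  by move=> i j _; rewrite setDv inE.
pose P C := `[< [/\ C \subset A, C != set0 & cut_closed C A] >].
move=> PA; have [C /minsetP[/asboolP[CA C0 cC] mC] _] := minset_exists (P := P) PA.
exists C; split=> //; split=> // K KC K0 cK; apply: mC => //; apply/asboolP.
split=> //; first exact: subset_trans CA.
move=> i j iK; rewrite inE => /andP[jK jA]; case: (boolP (j \in C)) => jC.
  by apply: cK; rewrite // inE jK.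
by apply: cC; [exact: (subsetP KC) | rewrite inE jC].
Qed.

(** Used with [C] a component of what remains of [A] without [B]: every other remaining piece is
    still attached to [B], so removing [C] disconnects nothing. *)
Lemma conn_remove A B C : conn A -> conn B -> B \subset A -> C \subset A :\: B ->
  cut_closed C (A :\: B) -> conn (A :\: C).
Proof.
move=> cA cB BA CA cC; have [/set0Pn[b bB] _] := cB.
have bC : b \notin C by apply/negP=> /(subsetP CA); rewrite inE bB.
have BAC : B \subset A :\: C.
  apply/subsetP=> x xB; rewrite inE (subsetP BA) // andbT.
  by apply/negP=> /(subsetP CA); rewrite inE xB.
(* A set cut off in [A :\: C] that misses [b] misses all of the connected [B]; then no edge joins it
   to [C], and it is cut off in [A]. *)
have key K : cut_closed K (A :\: C) -> K \subset A :\: C -> b \notin K -> K = set0.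
  move=> cK KAC bK; apply/eqP/set0Pn => -[x xK].
  have KB y : y \in K -> y \notin B.
    by move=> yK; apply: contra bK => yB; apply: (subsetP (conn_sub cB BAC cK yB yK)).
  have cKA : cut_closed K A.
    move=> y z yK; rewrite inE => /andP[zK zA]; case: (boolP (z \in C)) => zC.
      rewrite e_sym; apply: cC => //.
      by have := subsetP KAC y yK; rewrite !inE KB // => /andP[-> ->].
    by apply: cK => //; rewrite !inE zK zC.
  have KA : K \subset A by exact: subset_trans KAC (subsetDl _ _).
  have K0 : K != set0 by apply/set0Pn; exists x.
  by case/negP: bK; rewrite (cA.2 K KA K0 cKA) (subsetP BA).
split; first by apply/set0Pn; exists b; apply: (subsetP BAC).
move=> K KAC K0 cK; case: (boolP (b \in K)) => bK; last first.
  by rewrite (key K cK KAC bK) eqxx in K0.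
(* Here [key] is applied to the complement of [K], which misses [b]. *)
apply/eqP; rewrite eqEsubset KAC -setD_eq0; apply/eqP/key.
- exact: cut_closedC.
- exact: subsetDl.
- by rewrite inE bK.
Qed.

End CutConnected.

(** * Linear identities behind the commutation relation *)

Section ScaleIdentities.

Variables (F : fieldType) (V : lmodType F).
Implicit Types (x y z w : V) (c d k l : F).

Lemma scale_add x y x' y' c k :
  x + c *: y - k *: (x' + c *: y') = c *: (y - k *: y') + (x - k *: x').
Proof. by rewrite scalerBr scalerDr !scalerA [k * c]mulrC opprD addrACA addrC. Qed.

(** The mixed terms [y] and [z] occur in both halves of the difference and cancel, the latter
    because [k * l = 1]; this is what makes the commutator primitive. *)
Lemma scale_comm x y z w x' w' c d k l : k * l = 1 ->
  x + (k * d) *: y + c *: (z + d *: w) - k *: (x' + (l * c) *: z + d *: (y + c *: w')) =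
  (c * d) *: (w - k *: w') + (x - k *: x').
Proof.
move=> kl; set t := c *: z + (k * d) *: y.
have -> : x + (k * d) *: y + c *: (z + d *: w) = x + t + (c * d) *: w.
  by rewrite scalerDr scalerA addrA -(addrA x) [(k * d) *: y + _]addrC.
have -> : k *: (x' + (l * c) *: z + d *: (y + c *: w')) =
    k *: x' + t + (c * d) *: (k *: w').
  have kdc : k * d * c = c * d * k by rewrite -mulrA mulrC [d * c]mulrC.
  by rewrite !scalerDr !scalerA mulrA kl mul1r kdc !addrA.
rewrite [x + t]addrC [_ + t]addrC -[t + x + _]addrA -[t + k *: x' + _]addrA opprD addrACA subrr add0r.
by rewrite opprD addrACA scalerBr addrC.
Qed.

End ScaleIdentities.

(** The antipode reverses words, so it exchanges the two terms of a relation; [k * l = 1] makes the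
    result proportional to a relation again. *)
Lemma scale_anticomm (F : fieldType) (A : algType F) (x r s : A) (a b k l : F) :
  k * l = 1 ->
  - ((k * a) *: (- (b *: (x * s)) * r)) - k *: - ((l * b) *: (- (a *: (x * r)) * s)) =
  - (a * b) *: (x * (r * s - k *: (s * r))).
Proof.
move=> kl; rewrite !mulNr -!scalerAl !scalerN !opprK -!mulrA mulrBr -scalerAr.
have E : k * (l * b) * a = a * b by rewrite !mulrA kl mul1r mulrC.
by rewrite scalerBr !scaleNr opprK !scalerA addrC E -(mulrA k) (mulrC k).
Qed.

(** * The tensor algebra in terms of words *)

Section NicholsAlgebra.

Variables (F : fieldType) (n : nat) (p : 'M[F]_n).
Hypothesis p_neq0 : forall i j, p i j != 0.

Local Notation word := {fmonom 'I_n}.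
Local Notation T := (tensor_alg F n).
Local Notation T2 := (tensor_sq F n).
Local Notation B := (nichols_alg p).
Local Notation J := (nichols_ideal p).
Implicit Types (i j : 'I_n) (u v w : seq 'I_n) (a b : word) (f g : T).

(** The bicharacter on the degrees of two words (see [bichar_wdeg]), as a product over letters that
    splits along concatenation. *)
Definition chi u v : F := \prod_(i <- u) \prod_(j <- v) p i j.

Lemma chi_neq0 u v : chi u v != 0.
Proof.
rewrite prodf_seq_neq0; apply/allP=> i _ /=.
by rewrite prodf_seq_neq0; apply/allP=> j _ /=.
Qed.

Lemma chi_catl u v w : chi (u ++ v) w = chi u w * chi v w.
Proof. exact: big_cat. Qed.

Lemma chi_catr u v w : chi u (v ++ w) = chi u v * chi u w.
Proof. by rewrite -big_split; apply: eq_bigr => i _; apply: big_cat. Qed.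

Lemma chi0l v : chi [::] v = 1.
Proof. exact: big_nil. Qed.

Lemma chi0r u : chi u [::] = 1.
Proof. by apply: big1 => i _; apply: big_nil. Qed.

Lemma chi11 i j : chi [:: i] [:: j] = p i j.
Proof. by rewrite /chi !big_seq1. Qed.

Lemma bichar_wdeg u v : bichar p (wdeg u) (wdeg v) = chi u v.
Proof.
have bichar0l d : bichar p 0 d = 1.
  apply: (mulfI (bichar_neq0 p_neq0 0 d)).
  by rewrite -(bicharDl p_neq0) addr0 mulr1.
have bichar0r d : bichar p d 0 = 1.
  apply: (mulfI (bichar_neq0 p_neq0 d 0)).
  by rewrite -(bicharDr p_neq0) addr0 mulr1.
elim: u => [|i u IHu]; first by rewrite chi0l wdeg_nil bichar0l.
rewrite -(cat1s i u) chi_catl wdeg_cat (bicharDl p_neq0) {}IHu; congr (_ * _).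
elim: v => [|j v IHv]; first by rewrite chi0r wdeg_nil bichar0r.
rewrite -(cat1s j v) chi_catr wdeg_cat (bicharDr p_neq0) {}IHv; congr (_ * _).
by rewrite chi11 /wdeg !big_seq1 bichar_delta.
Qed.

(* The basis elements of T(V) and of T(V) (x) T(V), locked since comparing two
   of them by computation is expensive. *)
Fact tword_key : unit. Proof. by []. Qed.
Definition tword : seq 'I_n -> T := locked_with tword_key (fun u => << FMonom u >>).
Definition tword2 : seq 'I_n -> seq 'I_n -> T2 :=
  locked_with tword_key (fun u v => << (FMonom u, FMonom v) >>).

Lemma twordE u : tword u = << FMonom u >>.
Proof. by rewrite /tword locked_withE. Qed.

Lemma tword2E u v : tword2 u v = << (FMonom u, FMonom v) >>.
Proof. by rewrite /tword2 locked_withE. Qed.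

Lemma tword_linear_eq (V : lmodType F) (phi psi : T -> V) :
  linear phi -> linear psi -> (forall u, phi (tword u) = psi (tword u)) -> phi =1 psi.
Proof.
by move=> lphi lpsi E; apply: linear_eq => // -[u]; rewrite -twordE; apply: E.
Qed.

Lemma tword2_linear_eq (V : lmodType F) (phi psi : T2 -> V) :
  linear phi -> linear psi -> (forall u v, phi (tword2 u v) = psi (tword2 u v)) ->
  phi =1 psi.
Proof. by move=> lphi lpsi E; apply: linear_eq => // -[[u] [v]]; rewrite -tword2E; apply: E. Qed.

Lemma tword0 : 1 = tword [::].
Proof. by rewrite twordE -fmoneE. Qed.

Lemma tgenE i : tgen F i = tword [:: i].
Proof. by rewrite twordE /tgen fmuE. Qed.

Lemma mmulF u v : mmul (FMonom u) (FMonom v) = FMonom (u ++ v) :> word.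
Proof. by apply: val_inj; rewrite /= fmM. Qed.

Lemma twordM u v : tword u * tword v = tword (u ++ v).
Proof. by rewrite !twordE malgMUU mmulF. Qed.

Lemma tens_tword u v : tens (tword u) (tword v) = tword2 u v.
Proof. by rewrite !twordE tword2E; apply: tensUU. Qed.

Lemma tsq_mul_tword2 (u1 u2 v1 v2 : seq 'I_n) :
  tsq_mul p (tword2 u1 u2) (tword2 v1 v2) = chi u2 v1 *: tword2 (u1 ++ v1) (u2 ++ v2).
Proof. by rewrite !tword2E /tsq_mul !linextU /= bichar_wdeg !mmulF. Qed.

(** * The coproduct letter by letter, and the skew derivations it yields *)

Definition cop_gen i : T2 -> T2 := tsq_mul p
  (tword2 [:: i] [::] + tword2 [::] [:: i]).

Lemma cop_gen_lin i : linear (cop_gen i).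
Proof. exact: tsq_mul_linr. Qed.

Lemma cop_genU i u v : cop_gen i (tword2 u v) =
  tword2 (i :: u) v + chi [:: i] u *: tword2 u (i :: v).
Proof.
have addU (s t : T2) x : tsq_mul p (s + t) x = tsq_mul p s x + tsq_mul p t x.
  by have := tsq_mul_linl p x 1 s t; rewrite !scale1r.
by rewrite /cop_gen addU !tsq_mul_tword2 chi0l scale1r.
Qed.

Definition cop_word : seq 'I_n -> T2 := locked_with tword_key (coprod_word p).

Lemma coprod_lin : linear (coprod p : T -> T2).
Proof. exact: linextP. Qed.

Lemma coprodU w : coprod p (tword w) = cop_word w.
Proof. by rewrite twordE /cop_word locked_withE; apply: linextU. Qed.

Lemma cop_word0 : cop_word [::] = tword2 [::] [::].
Proof. by rewrite /cop_word locked_withE -tens_tword -tword0. Qed.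

Lemma cop_word_cons i w : cop_word (i :: w) = cop_gen i (cop_word w).
Proof.
have El : tens (tgen F i) 1 = tword2 [:: i] [::] by rewrite tgenE tword0 tens_tword.
have Er : tens 1 (tgen F i) = tword2 [::] [:: i] by rewrite tgenE tword0 tens_tword.
by rewrite /cop_word locked_withE /cop_gen -El -Er.
Qed.

(* Applied after the coproduct, the coefficient of [x_i] in the left tensor
   factor is a skew derivation, and that of [1] is the identity. *)
Definition lcoef u : T2 -> T :=
  linext (fun ab : word * word => if ab.1 == FMonom u then << ab.2 >> else 0 : T).

Lemma lcoefU u v1 v2 : lcoef u (tword2 v1 v2) = if v1 == u then tword v2 else 0.
Proof. by rewrite tword2E twordE; apply: linextU. Qed.

Lemma lcoef_lin u : linear (lcoef u).
Proof. exact: linextP. Qed.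

Lemma lcoefD u x y : lcoef u (x + y) = lcoef u x + lcoef u y.
Proof. by have := lcoef_lin u 1 x y; rewrite !scale1r. Qed.

Lemma mcoeff_tword u v : (tword u)@_(FMonom v) = (u == v)%:R.
Proof. by rewrite twordE; apply: mcoeffU. Qed.

Lemma lcoef_tensl u f v : lcoef u (tens f (tword v)) = f@_(FMonom u) *: tword v.
Proof.
move: f; apply: tword_linear_eq => [||w].
- exact: linear_comp (lcoef_lin _) (tens_linl _).
- by move=> c x y; rewrite mcoeffD mcoeffZ scalerDl scalerA.
- rewrite tens_tword lcoefU mcoeff_tword.
  by case: eqP => _; rewrite ?scale1r ?scale0r.
Qed.

Lemma lcoef_tensr u v f : lcoef u (tens (tword v) f) = if v == u then f else 0.
Proof.
move: f; apply: tword_linear_eq => [||w].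
- exact: linear_comp (lcoef_lin _) (tens_linr _).
- by move=> c x y; case: ifP; rewrite ?scaler0 ?addr0.
- by rewrite tens_tword lcoefU.
Qed.

Lemma lcoef0_cop_gen i t : lcoef [::] (cop_gen i t) = tword [:: i] * lcoef [::] t.
Proof.
move: t; apply: tword2_linear_eq => [||u v].
- exact: linear_comp (lcoef_lin _) (cop_gen_lin _).
- exact: linear_comp (@mulr_linr _ _ _) (lcoef_lin _).
- rewrite cop_genU lcoefD (linZ _ _ (lcoef_lin _)) !lcoefU add0r.
  case: eqP => [->|_]; last by rewrite scaler0 mulr0.
  by rewrite chi0r scale1r twordM.
Qed.

Lemma lcoef0_coprod w : lcoef [::] (cop_word w) = tword w.
Proof.
elim: w => [|i w IHw]; first by rewrite cop_word0 lcoefU.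
by rewrite cop_word_cons lcoef0_cop_gen IHw twordM.
Qed.

(** The skew Leibniz rule: the [i] in the left factor is either the new letter [j], or was there
    before, and then [x_j] passes it by the braiding at the cost of [p j i]. *)
Lemma lcoef1_cop_gen i j t : lcoef [:: i] (cop_gen j t) =
  (j == i)%:R *: lcoef [::] t + p j i *: (tword [:: j] * lcoef [:: i] t).
Proof.
move: t; apply: tword2_linear_eq => [||u v].
- exact: linear_comp (lcoef_lin _) (cop_gen_lin _).
- apply: linear_add; first exact: linear_scale (lcoef_lin _).
  exact: linear_scale (linear_comp (@mulr_linr _ _ _) (lcoef_lin _)).
- rewrite cop_genU lcoefD (linZ _ _ (lcoef_lin _)) !lcoefU eqseq_cons.
  case: (eqVneq u [:: i]) => [->|_]; first by rewrite chi11 twordM andbF scaler0.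
  rewrite mulr0 !scaler0 !addr0.
  by do 2!case: eqP => _ /=; rewrite ?scale1r ?scale0r ?scaler0.
Qed.

Lemma lcoef1_notin i w : i \notin w -> lcoef [:: i] (cop_word w) = 0.
Proof.
elim: w => [|j w IHw]; first by rewrite cop_word0 lcoefU.
rewrite inE negb_or eq_sym => /andP[/negPf ji /IHw E].
by rewrite cop_word_cons lcoef1_cop_gen E ji scale0r mulr0 scaler0 addr0.
Qed.

Lemma nichols_ideal0 : J 0.
Proof. by case: (nichols_ideal_subspace p). Qed.

(** [J] is a coideal. A term with left factor in [J] has no coefficient at [x_i], as [J] starts in
    degree 2; a term with right factor in [J] is sent into [J]. *)
Lemma nichols_ideal_lcoef i f : J f -> J (lcoef [:: i] (coprod p f)).
Proof.
move=> Jf; have Jcop := bhi_coprod (nichols_ideal_bhi p_neq0) Jf.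
move: (coprod p f) Jcop; apply: ideal_tens_ind => [|g [b] Jg|g [b] Jg].
- exact: subspace_preim (lcoef_lin _) (nichols_ideal_subspace p).
- rewrite -twordE lcoef_tensl; suff -> : g@_(FMonom [:: i]) = 0.
    by rewrite scale0r; apply: nichols_ideal0.
  by apply: mcoeff_outdom; apply/negP=> /(nichols_ideal_ge2 Jg).
- by rewrite -twordE lcoef_tensr; case: ifP => // _; apply: nichols_ideal0.
Qed.

Lemma nmonE w : nmon p w = \pi_B (tword w).
Proof.
rewrite /nmon; elim: w => [|i w IHw].
  by rewrite big_nil -tword0 pi_one.
by rewrite big_cons IHw -piM tgenE twordM.
Qed.

Lemma nmon_eq0 w : nmon p w = 0 -> J (tword w).
Proof.
rewrite nmonE => E; have /Defs.eq_piP : \pi_B (tword w) = \pi_B 0 :> B by rewrite E piE.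
by rewrite subr0.
Qed.

(** The skew derivation at the first letter [i] sends [i :: w] to [w] exactly, because [i] does not
    recur in [w]; in the end 1 would lie in [J]. *)
Lemma nmon_uniq_neq0 w : uniq w -> nmon p w != 0.
Proof.
move=> uw; apply/eqP => /nmon_eq0.
elim: w uw => [|i w IHw] /= => [_|/andP[iw uw]] Jw.
  have := nichols_ideal_ge2 Jw (w := FMonom [::]).
  by rewrite twordE msuppU oner_eq0 in_fset1 eqxx => /(_ isT).
apply: IHw => //; have := nichols_ideal_lcoef i Jw.
rewrite coprodU cop_word_cons lcoef1_cop_gen lcoef0_coprod lcoef1_notin //.
by rewrite eqxx scale1r mulr0 scaler0 addr0.
Qed.

Lemma nmon_cat u v : nmon p (u ++ v) = nmon p u * nmon p v.
Proof. exact: big_cat. Qed.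

(** * The commutation relation of two letters with [p r s * p s r = 1] *)

Section CommutationIdeal.

Variables r s : 'I_n.
Hypothesis rs1 : p r s * p s r = 1.

Definition crel u v : T := tword (u ++ [:: r, s & v]) - p r s *: tword (u ++ [:: s, r & v]).

(* The two-sided ideal generated by [x_r x_s - p_rs x_s x_r]; the generator is
   primitive exactly because [p_rs p_sr = 1]. *)
Definition crel_ideal : T -> Prop := Defs.span (fun f => exists u v, f = crel u v).

Local Notation I := crel_ideal.
Local Notation K := (ideal_tens crel_ideal).

Lemma crel_subspace : is_subspace I.
Proof. exact: span_subspace. Qed.

Lemma crel_tens_subspace : is_subspace K.
Proof. exact: ideal_tens_subspace. Qed.

Lemma crel_in u v : I (crel u v).
Proof. by apply: span_in; exists u, v. Qed.

Lemma crel_ind (W : T -> Prop) : is_subspace W -> (forall u v, W (crel u v)) ->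
  forall f, I f -> W f.
Proof. by move=> sW WI f; apply=> // _ [u [v ->]]. Qed.

Lemma crel_tens_ind (W : T2 -> Prop) : is_subspace W ->
  (forall u v w, W (tens (crel u v) (tword w))) ->
  (forall u v w, W (tens (tword w) (crel u v))) ->
  forall t, K t -> W t.
Proof.
move=> sW Wl Wr; apply: ideal_tens_ind => [||]; first exact: sW.
  move=> f [w]; rewrite -twordE; move: f; apply: crel_ind => [|u v]; last exact: Wl.
  exact: subspace_preim (tens_linl _) sW.
move=> f [w]; rewrite -twordE; move: f; apply: crel_ind => [|u v]; last exact: Wr.
exact: subspace_preim (tens_linr _) sW.
Qed.

Lemma crel_mull w u v : tword w * crel u v = crel (w ++ u) v.
Proof.
rewrite /crel (linB _ _ (@mulr_linr _ _ _)) (linZ _ _ (@mulr_linr _ _ _)).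
by rewrite !twordM !catA.
Qed.

Lemma crel_mulr w u v : crel u v * tword w = crel u (v ++ w).
Proof.
rewrite /crel (linB _ _ (@mulr_linl _ _ _)) (linZ _ _ (@mulr_linl _ _ _)).
by rewrite !twordM -!catA.
Qed.

Lemma tens_crell u v w : tens (crel u v) (tword w) =
  tword2 (u ++ [:: r, s & v]) w - p r s *: tword2 (u ++ [:: s, r & v]) w.
Proof.
rewrite /crel (linB _ _ (tens_linl _)) (linZ _ _ (tens_linl _)).
by rewrite !tens_tword.
Qed.

Lemma tens_crelr u v w : tens (tword w) (crel u v) =
  tword2 w (u ++ [:: r, s & v]) - p r s *: tword2 w (u ++ [:: s, r & v]).
Proof.
rewrite /crel (linB _ _ (tens_linr _)) (linZ _ _ (tens_linr _)).
by rewrite !tens_tword.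
Qed.

(** The two words of a relation have the same letters, so [chi] takes the same value on both and
    factors out of the relation. *)
Lemma crel_perm u v : perm_eq (u ++ [:: r, s & v]) (u ++ [:: s, r & v]).
Proof. by rewrite perm_cat2l -(cat1s r) -(cat1s s) perm_catCA. Qed.

Lemma chi_permr w u v : perm_eq u v -> chi w u = chi w v.
Proof. by move=> uv; apply: eq_bigr => i _; apply: perm_big. Qed.

Lemma chi_perml w u v : perm_eq u v -> chi u w = chi v w.
Proof. exact: perm_big. Qed.

Lemma chi_cons1 i u w : chi w (i :: u) = chi w [:: i] * chi w u.
Proof. exact: chi_catr w [:: i] u. Qed.

Lemma crel_ideal_mull f g : I g -> I (f * g).
Proof.
move: g; apply: crel_ind => [|u v].
  exact: subspace_preim (@mulr_linr _ _ f) crel_subspace.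
move: f; apply: malg_subspace => [|[w]].
  exact: subspace_preim (@mulr_linl _ _ _) crel_subspace.
by rewrite -twordE crel_mull; apply: crel_in.
Qed.

Lemma crel_ideal_mulr f g : I f -> I (f * g).
Proof.
move: f; apply: crel_ind => [|u v].
  exact: subspace_preim (@mulr_linl _ _ g) crel_subspace.
move: g; apply: malg_subspace => [|[w]].
  exact: subspace_preim (@mulr_linr _ _ _) crel_subspace.
by rewrite -twordE crel_mulr; apply: crel_in.
Qed.

(** The case of an empty prefix in [coprod_crel]. The terms with one of the letters in each tensor
    factor cancel by [scale_comm], which leaves a relation in the left factor and one in the
    right. *)
Lemma cop_gen_commutator t : K (cop_gen r (cop_gen s t) - p r s *: cop_gen s (cop_gen r t)).
Proof.
have cgD i (x y : T2) : cop_gen i (x + y) = cop_gen i x + cop_gen i y.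
  by have := cop_gen_lin i 1 x y; rewrite !scale1r.
have cgZ i (c : F) (x : T2) : cop_gen i (c *: x) = c *: cop_gen i x.
  exact: linZ (cop_gen_lin i).
move: t; apply: malg_subspace => [|[[u] [v]]].
  apply: (subspace_preim _ crel_tens_subspace).
  under eq_fun do rewrite -scaleNr.
  apply: linear_add; first exact: linear_comp (cop_gen_lin _) (cop_gen_lin _).
  exact: linear_scale (linear_comp (cop_gen_lin _) (cop_gen_lin _)).
rewrite -tword2E !cop_genU !cgD !cgZ !cop_genU.
rewrite [chi _ (s :: u)]chi_cons1 [chi _ (r :: u)]chi_cons1 !chi11.
rewrite scale_comm // -(tens_crell [::]) -(tens_crelr [::]).
apply: (crel_tens_subspace.2); first exact: ideal_tensr (crel_in _ _).
exact: ideal_tensl (crel_in _ _).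
Qed.

Lemma cop_gen_ideal_tens i t : K t -> K (cop_gen i t).
Proof.
move: t; apply: crel_tens_ind => [|u v w|u v w].
- exact: subspace_preim (cop_gen_lin i) crel_tens_subspace.
- rewrite tens_crell (linB _ _ (cop_gen_lin i)) (linZ _ _ (cop_gen_lin i)) !cop_genU.
  rewrite -(chi_permr [:: i] (crel_perm u v)) scale_add -(tens_crell u) -(tens_crell (i :: u)).
  by apply: (crel_tens_subspace.2); apply: ideal_tensl (crel_in _ _).
- rewrite tens_crelr (linB _ _ (cop_gen_lin i)) (linZ _ _ (cop_gen_lin i)) !cop_genU.
  rewrite scale_add -(tens_crelr u) -(tens_crelr (i :: u)).
  by apply: (crel_tens_subspace.2); apply: ideal_tensr (crel_in _ _).
Qed.

(** The letters of the prefix [u] are peeled off one by one; each acts by [cop_gen], which preserves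
    [ideal_tens crel_ideal]. *)
Lemma coprod_crel u v : K (coprod p (crel u v)).
Proof.
rewrite /crel (linB _ _ coprod_lin) (linZ _ _ coprod_lin) !coprodU.
elim: u => [|i u IHu].
  by rewrite !cat0s !cop_word_cons; exact: cop_gen_commutator.
rewrite !cat_cons !(cop_word_cons i) -(linZ _ _ (cop_gen_lin i)).
by rewrite -(linB _ _ (cop_gen_lin i)); apply: cop_gen_ideal_tens.
Qed.

Lemma deg_ge2_subspace : is_subspace (@deg_ge2 F n).
Proof.
split=> [w|c x y hx hy w]; first by rewrite msupp0 inE.
move/(fsubsetP (msuppD_le _ _)); rewrite in_fsetU => /orP[|/hy //].
by move/(fsubsetP (msuppZ_le _ _)) => /hx.
Qed.

Lemma crel_ideal_ge2 f : I f -> deg_ge2 f.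
Proof.
have ge2 w : (2 <= size w)%N -> deg_ge2 (tword w).
  by move=> w2 x; rewrite twordE => /(fsubsetP msuppU_le); rewrite in_fset1 => /eqP ->.
move: f; apply: crel_ind => [|u v]; first exact: deg_ge2_subspace.
rewrite /crel -scaleNr addrC; apply: deg_ge2_subspace.2; apply: ge2.
  by rewrite size_cat /= !addnS.
by rewrite size_cat /= !addnS.
Qed.

Lemma antipode_lin : linear (antipode p : T -> T).
Proof. exact: linextP. Qed.

Definition ant_word : seq 'I_n -> T := locked_with tword_key (antipode_word p).

Lemma antipodeU w : antipode p (tword w) = ant_word w.
Proof. by rewrite twordE /ant_word locked_withE; apply: linextU. Qed.

Lemma ant_word_cons i w :
  ant_word (i :: w) = - (chi [:: i] w *: (ant_word w * tword [:: i])).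
Proof. by rewrite /ant_word locked_withE /= bichar_wdeg tgenE. Qed.

Lemma antipode_crel u v : I (antipode p (crel u v)).
Proof.
rewrite /crel (linB _ _ antipode_lin) (linZ _ _ antipode_lin) !antipodeU.
elim: u => [|i u IHu].
  rewrite !cat0s !ant_word_cons.
  rewrite [chi _ (s :: v)]chi_cons1 [chi _ (r :: v)]chi_cons1 !chi11 scale_anticomm //.
  rewrite !twordM -[_ - _]/(crel [::] [::]).
  by apply: (subspaceZ _ crel_subspace); apply: crel_ideal_mull; apply: crel_in.
rewrite !cat_cons !(ant_word_cons i) -(chi_permr [:: i] (crel_perm u v)).
rewrite scalerN -opprD scalerA mulrC -scalerA -scalerBr scalerAl -mulrBl -scaleN1r.
by do 2!apply: (subspaceZ _ crel_subspace); apply: crel_ideal_mulr.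
Qed.

Lemma braid_tword2 u v : braid p (tword2 u v) = chi u v *: tword2 v u.
Proof. by rewrite !tword2E braidU bichar_wdeg. Qed.

Lemma braid_inv_tword2 u v : braid_inv p (tword2 u v) = (chi v u)^-1 *: tword2 v u.
Proof. by rewrite !tword2E braid_invU bichar_wdeg. Qed.

(** The braiding and its inverse move a relation to the other tensor factor, up to a scalar common
    to its two words. *)
Lemma crel_braid t : K (braid p t) <-> K t.
Proof.
have l1 := @braid_lin _ _ p; have l2 := @braid_inv_lin _ _ p.
apply: (braid_iff p_neq0); apply: crel_tens_ind => [|u v w|u v w].
- exact: subspace_preim l1 crel_tens_subspace.
- rewrite tens_crell (linB _ _ l1) (linZ _ _ l1) !braid_tword2.
  rewrite -(chi_perml w (crel_perm u v)) scalerA mulrC -scalerA -scalerBr -tens_crelr.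
  by apply: (subspaceZ _ crel_tens_subspace); apply: ideal_tensr (crel_in _ _).
- rewrite tens_crelr (linB _ _ l1) (linZ _ _ l1) !braid_tword2.
  rewrite -(chi_permr w (crel_perm u v)) scalerA mulrC -scalerA -scalerBr -tens_crell.
  by apply: (subspaceZ _ crel_tens_subspace); apply: ideal_tensl (crel_in _ _).
- exact: subspace_preim l2 crel_tens_subspace.
- rewrite tens_crell (linB _ _ l2) (linZ _ _ l2) !braid_inv_tword2.
  rewrite -(chi_permr w (crel_perm u v)) scalerA mulrC -scalerA -scalerBr -tens_crelr.
  by apply: (subspaceZ _ crel_tens_subspace); apply: ideal_tensr (crel_in _ _).
- rewrite tens_crelr (linB _ _ l2) (linZ _ _ l2) !braid_inv_tword2.
  rewrite -(chi_perml w (crel_perm u v)) scalerA mulrC -scalerA -scalerBr -tens_crell.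
  by apply: (subspaceZ _ crel_tens_subspace); apply: ideal_tensl (crel_in _ _).
Qed.

Lemma crel_ideal_bhi : braided_hopf_ideal p I.
Proof.
split.
- exact: crel_subspace.
- exact: crel_ideal_mull.
- exact: crel_ideal_mulr.
- apply: crel_ind => [|u v]; last exact: coprod_crel.
  exact: subspace_preim (linextP _) crel_tens_subspace.
- by move=> f /crel_ideal_ge2 f2; apply: mcoeff_outdom; apply/negP=> /f2; rewrite fm1.
- apply: crel_ind => [|u v]; last exact: antipode_crel.
  exact: subspace_preim (linextP _) crel_subspace.
- exact: crel_braid.
Qed.

(** [crel_ideal] is a braided Hopf ideal in degrees at least 2, so the Nichols ideal, being the
    largest of these, contains it. *)
Lemma nmon_commute : nmon p [:: r; s] = p r s *: nmon p [:: s; r].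
Proof.
rewrite !nmonE -piZ; apply/Defs.eq_piP.
exact: nichols_ideal_max crel_ideal_bhi crel_ideal_ge2 _ (crel_in [::] [::]).
Qed.

End CommutationIdeal.

(** * Commutation of monomials with unlinked supports *)

Local Notation X := (nmon p).
Local Notation L := (@nichols_lie F n p).
Local Notation e := (dynkin p).

(** Distinctness is asked for separately: [dynkin] has no loops, so [~~ e i i] says nothing about
    [p i i]. *)
Definition apart u v := forall i j, i \in u -> j \in v -> (i != j) && ~~ e i j.

Lemma dynkin_sym : symmetric e.
Proof. by move=> i j; rewrite /dynkin eq_sym mulrC. Qed.

Lemma apart_consl i u v : apart (i :: u) v -> apart [:: i] v /\ apart u v.
Proof.
move=> h; split=> k j; last by move=> ku; apply: h; rewrite inE ku orbT.
by rewrite inE => /eqP ->; apply: h; rewrite inE eqxx.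
Qed.

Lemma apart_sym u v : apart u v -> apart v u.
Proof. by move=> h i j iv ju; rewrite eq_sym dynkin_sym; apply: h. Qed.

(** A single letter is moved through a word by [nmon_commute], then the letters of [u] follow one
    after the other; the scalars multiply to [chi u v]. *)
Lemma nmon_apart u v : apart u v -> X (u ++ v) = chi u v *: X (v ++ u).
Proof.
have one i w : apart [:: i] w -> X (i :: w) = chi [:: i] w *: X (w ++ [:: i]).
  elim: w => [|j w IHw]; first by rewrite chi0r scale1r.
  move=> /apart_sym/apart_consl[/apart_sym ij /apart_sym/IHw E].
  have pij : p i j * p j i = 1.
    have := ij i j; rewrite !inE !eqxx => /(_ isT isT); rewrite /dynkin.
    by case: eqP => //= _ /negPn/eqP.
  rewrite -(cat1s i) -(cat1s j w) catA nmon_cat (nmon_commute pij) -nichols_scaleAl.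
  rewrite -nmon_cat /= -(cat1s j) nmon_cat E -nichols_scaleAr -nmon_cat scalerA.
  by rewrite -chi11 -chi_catr.
elim: u v => [|i u IHu] v; first by rewrite chi0l scale1r cats0.
move=> /apart_consl[iv uv]; rewrite cat_cons -(cat1s i (u ++ v)) nmon_cat (IHu _ uv).
rewrite -nichols_scaleAr -nmon_cat catA nmon_cat cat1s (one _ _ iv) -nichols_scaleAl.
by rewrite -nmon_cat -catA scalerA mulrC -chi_catl.
Qed.

Lemma chi_swap u v : chi u v * chi v u = \prod_(i <- u) \prod_(j <- v) (p i j * p j i).
Proof.
rewrite /chi [X in _ * X]exchange_big -big_split; apply: eq_bigr => i _.
by rewrite big_split.
Qed.

Lemma chi_apart u v : apart u v -> chi u v * chi v u = 1.
Proof.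
move=> h; rewrite chi_swap big1_seq // => i /andP[_ iu]; rewrite big1_seq // => j /andP[_ jv].
by have := h i j iu jv; rewrite /dynkin; case: eqP => //= _ /negPn/eqP.
Qed.

Lemma bracket_nmon u v : bracket (X u) (X v) = X (v ++ u) - chi v u *: X (u ++ v).
Proof.
rewrite !nmonE (pi_bracket p_neq0) !twordE (tbracketUU p) bichar_wdeg !mmulF -!twordE.
by rewrite (linB _ _ (@pi_linear _ _ p)) piZ.
Qed.

(** * The subspace L(V) and congruence modulo it *)

Lemma lie_subspace : is_subspace L.
Proof.
split=> [W [W0 _] _ _ //|c x y Lx Ly W sW Wg Wb].
by apply: sW.2; [apply: Lx | apply: Ly].
Qed.

Lemma nmon1 i : X [:: i] = ngen p i.
Proof. exact: big_seq1. Qed.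

Lemma lie_nmon1 i : L (X [:: i]).
Proof. by move=> W _ Wg _; rewrite nmon1. Qed.

Lemma lie_bracket x y : L x -> L y -> L (bracket x y).
Proof. by move=> Lx Ly W sW Wg Wb; apply: (Wb _ _ (Lx W sW Wg Wb) (Ly W sW Wg Wb)). Qed.

(** Only linear operations are applied to this congruence: words are rewritten modulo L(V) as a
    whole, never inside a product. *)
Definition eqL (x y : B) := L (x - y).

Lemma eqL_refl x : eqL x x.
Proof. by rewrite /eqL subrr; case: lie_subspace. Qed.

Lemma eqL_trans x y z : eqL x y -> eqL y z -> eqL x z.
Proof.
by move=> xy yz; rewrite /eqL -(subrKA y); apply: (subspaceD lie_subspace).
Qed.

Lemma eqLZ c x y : eqL x y -> eqL (c *: x) (c *: y).
Proof. by move=> xy; rewrite /eqL -scalerBr; apply: (subspaceZ _ lie_subspace). Qed.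

Lemma eqL_lie x y : eqL x y -> L y -> L x.
Proof. by move=> xy Ly; rewrite -(subrK y x); apply: (subspaceD lie_subspace). Qed.

Lemma lieZ c x : c != 0 -> L (c *: x) -> L x.
Proof.
move=> c0 /(subspaceZ c^-1 lie_subspace).
by rewrite scalerA mulVf // scale1r.
Qed.

Definition swappable u v := eqL (X (u ++ v)) (chi u v *: X (v ++ u)).

Lemma lie_swappable u v : L (X u) -> L (X v) -> swappable u v.
Proof. by move=> Lu Lv; rewrite /swappable /eqL -bracket_nmon; apply: lie_bracket. Qed.

(** * Supports of monomials in L(V) *)

Lemma mem_mu w i : (i \in mu w) = (i \in w).
Proof. by rewrite inE. Qed.

Lemma mu_cat u v : mu (u ++ v) = mu u :|: mu v.
Proof. by apply/setP=> i; rewrite !inE mem_cat. Qed.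

Lemma mu_perm u v : perm_eq u v -> mu u = mu v.
Proof. by move=> /perm_mem uv; apply/setP=> i; rewrite !inE uv. Qed.

Lemma not_conn_apart u v : conn e (mu u) -> conn e (mu v) ->
  ~ conn e (mu (u ++ v)) -> apart u v.
Proof.
move=> cu cv nc i j iu jv; apply/negPn/negP; rewrite negb_and !negbK => ij.
by apply: nc; rewrite mu_cat; apply: (connU dynkin_sym cu cv _ _ ij); rewrite mem_mu.
Qed.

Lemma wdegE w i : wdeg w 0 i = (count_mem i w)%:R.
Proof.
elim: w => [|j w IHw]; first by rewrite wdeg_nil mxE.
rewrite -(cat1s j w) wdeg_cat mxE IHw /wdeg big_seq1 mxE natrD /=.
by rewrite (eq_sym i).
Qed.

Lemma mu_wdeg u v : wdeg u = wdeg v -> mu u = mu v.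
Proof.
move=> uv; apply/setP=> i; rewrite !mem_mu -!has_pred1 !has_count.
by have := congr1 (fun d : 'rV[int]_n => d 0 i) uv; rewrite !wdegE !natz => -[->].
Qed.

(** The span is closed under brackets: if the joint support of two connected words is connected,
    both terms of their bracket lie in the span; otherwise the words are apart and the bracket is
    0. *)
Lemma lie_span_conn x : L x -> Defs.span (fun y => exists w, conn e (mu w) /\ y = X w) x.
Proof.
pose W := Defs.span (fun y => exists w, conn e (mu w) /\ y = X w).
have sW : is_subspace W by exact: span_subspace.
have WX w : conn e (mu w) -> W (X w) by move=> cw; apply: span_in; exists w.
apply=> // [i|y z Wy Wz].
  rewrite -nmon1; apply: WX.
  have -> : mu [:: i] = [set i] by apply/setP=> j; rewrite !inE.
  exact: conn1.
apply: (Wy (fun y => W (bracket y z))).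
  exact: subspace_preim (bracket_linl p_neq0 z) sW.
move=> _ [u [cu ->]]; apply: (Wz (fun z => W (bracket (X u) z))).
  exact: subspace_preim (bracket_linr p_neq0 (X u)) sW.
move=> _ [v [cv ->]]; rewrite bracket_nmon.
have [cuv|nuv] := pselect (conn e (mu (u ++ v))).
  have cvu : conn e (mu (v ++ u)) by rewrite (mu_perm (permEl (perm_catC v u))).
  rewrite addrC -scaleNr; apply: sW.2; exact: WX.
rewrite nmon_apart ?subrr; first by case: sW.
exact/apart_sym/not_conn_apart.
Qed.

Lemma lie_nmon_conn w : L (X w) -> X w != 0 -> conn e (mu w).
Proof.
move=> Lw nz; apply: contrapT => nc; case/negP: nz; apply/eqP.
pose comp f : T := hcomp (fun k : word => wdeg k) (wdeg w) f.
have comp_lin : linear comp by exact: hcomp_lin.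
(* Words with connected support satisfy [Q]: a word of the same degree as [w] has the support of
   [w], which is assumed disconnected. So all of L(V) satisfies [Q]. *)
pose Q (x : B) := exists2 f, x = \pi_B f & J (comp f).
have [f E Jf] : Q (X w).
  apply: (lie_span_conn Lw) => [|_ [u [cu ->]]].
    split=> [|c _ _ [f -> Jf] [g -> Jg]].
      by exists 0; rewrite ?piE // (lin0 comp_lin); apply: nichols_ideal0.
    exists (c *: f + g); first by rewrite (@pi_linear _ _ p).
    by rewrite comp_lin; apply: (nichols_ideal_subspace p).2.
  exists (tword u); first exact: nmonE.
  rewrite /comp twordE hcompU; case: eqP => [/mu_wdeg uw|_]; last exact: nichols_ideal0.
  by case: nc; rewrite -uw.
rewrite nmonE; suff Jw : J (tword w).
  have -> : \pi_B (tword w) = \pi_B (0 : T) :> B by apply/Defs.eq_piP; rewrite subr0.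
  by rewrite piE.
(* Homogeneity of [J] lets the representatives [tword w] and [f] be compared in the degree of [w]
   alone. *)
have E' : J (comp (tword w - f)).
  by apply: nichols_ideal_homog => //; apply/Defs.eq_piP; rewrite -nmonE.
have <- : comp (tword w - f) + comp f = tword w.
  by rewrite (linB _ _ comp_lin) subrK /comp twordE hcompU eqxx.
exact: (subspaceD (nichols_ideal_subspace p)).
Qed.

(** * Multilinear monomials with connected support lie in L(V) *)

Lemma nmon_filter (C : {set 'I_n}) v :
  (forall i j, i \in v -> j \in v -> i \in C -> j \notin C -> ~~ e i j) ->
  exists2 c, c != 0 &
    X v = c *: X ([seq i <- v | i \in C] ++ [seq i <- v | i \notin C]).
Proof.
elim: v => [|k v IHv] h; first by exists 1; rewrite ?oner_eq0 // scale1r.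
have [i j iv jv|c c0 E] := IHv; first by apply: h; rewrite inE ?iv ?jv orbT.
rewrite -(cat1s k v) nmon_cat E -nichols_scaleAr -nmon_cat /=.
case: (boolP (k \in C)) => kC /=; first by exists c.
(* A letter [k] outside [C] still has to pass all the letters of [C] behind it, with which it is
   unlinked. *)
exists (c * chi [:: k] [seq i <- v | i \in C]); first by rewrite mulf_neq0 ?chi_neq0.
rewrite -cat1s catA nmon_cat nmon_apart; last first.
  move=> i j; rewrite inE mem_filter => /eqP -> /andP[jC jv].
  rewrite dynkin_sym h ?inE ?jv ?eqxx ?orbT // andbT.
  by apply: contraNneq kC => ->.
by rewrite -nichols_scaleAl scalerA -nmon_cat -catA.
Qed.

Lemma mu_filter (C : {set 'I_n}) v :
  (mu [seq i <- v | i \in C] = mu v :&: C) * (mu [seq i <- v | i \notin C] = mu v :\: C).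
Proof. by split; apply/setP=> i; rewrite !inE mem_filter // andbC. Qed.

Lemma mu_catD u v : uniq (u ++ v) -> mu (u ++ v) :\: mu u = mu v.
Proof.
rewrite cat_uniq => /and3P[_ /hasPn uv _]; apply/setP=> i; rewrite !inE mem_cat.
by case: (boolP (i \in v)) => [/uv /= /negPf -> //|_]; rewrite orbF andNb.
Qed.

(* If [v] is disconnected, split off a component [v1], so that [v ~ v1 v2] with
   [v1] and [v2] commuting up to a scalar, and move first [v1], then [v2], past
   the connected rest. *)
Lemma swappable_conn m : (forall w, (size w < m)%N -> uniq w -> conn e (mu w) -> L (X w)) ->
  forall k u v, (size v <= k)%N -> size (u ++ v) = m -> uniq (u ++ v) ->
  conn e (mu u) -> conn e (mu (u ++ v)) -> swappable u v.
Proof.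
move=> IH; elim=> [|k IHk] u v vk sz uuv cu cuv.
  move: vk; rewrite leqn0 => /nilP ->.
  by rewrite /swappable cats0 chi0r scale1r; apply: eqL_refl.
have [->|v0] := eqVneq v [::].
  by rewrite /swappable cats0 chi0r scale1r; apply: eqL_refl.
have mv0 : mu v != set0.
  by case: v v0 {vk sz uuv cuv} => // x v _; apply/set0Pn; exists x; rewrite mem_mu inE eqxx.
have [C [CA cC clC]] := conn_closed_part e mv0.
have Dv := mu_catD uuv.
pose v1 := [seq i <- v | i \in C]; pose v2 := [seq i <- v | i \notin C].
have mv1 : mu v1 = C by rewrite (mu_filter C v).1; apply/setIidPr.
have mv2 : mu v2 = mu v :\: C by rewrite (mu_filter C v).2.
have pv : perm_eq (v1 ++ v2) v by apply/permPl/perm_filterC.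
have [/set0Pn[x xC] _] := cC.
have v1_gt0 : (0 < size v1)%N.
  by rewrite lt0n size_eq0; apply/eqP=> E; move: xC; rewrite -mv1 E mem_mu.
have sv : (size v1 + size v2)%N = size v by rewrite -size_cat (perm_size pv).
have a12 : apart v1 v2.
  move=> i j iv1 jv2; rewrite -mem_mu mv1 in iv1; rewrite -mem_mu mv2 in jv2.
  rewrite clC // andbT; apply: contraTneq jv2 => <-.
  by rewrite inE iv1.
(* [C] is a component of the graph on the letters other than those of [u], so [conn_remove]
   applies. *)
have cuv2 : conn e (mu (u ++ v2)).
  have -> : mu (u ++ v2) = mu (u ++ v) :\: C.
    rewrite !mu_cat mv2 setDUl; congr (_ :|: _); apply/esym/setDidPl.
    rewrite disjoint_sym; apply: disjointWl CA _; rewrite -Dv.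
    by rewrite disjoints_subset setDE subsetIr.
  apply: (conn_remove dynkin_sym cuv cu); rewrite ?Dv //.
  by rewrite mu_cat subsetUl.
have cv1u : conn e (mu (v1 ++ u)).
  (* Some edge leaves [C] inside the connected support of [u ++ v]; it cannot end in the rest of
     [v], hence it ends in [u]. *)
  have [|||i [j [iC]]] := conn_edge cuv (K := C).
  - by rewrite mu_cat (subset_trans CA) ?subsetUr.
  - by apply/set0Pn; exists x.
  - have [/set0Pn[y yu] _] := cu; apply/eqP=> E.
    have : y \in mu v by apply: (subsetP CA); rewrite E mu_cat inE yu.
    by rewrite -Dv inE yu.
  rewrite mu_cat in_setD in_setU => /andP[jC /orP[ju|jv]] eij; last first.
    suff : ~~ e i j by rewrite eij.
    by apply: clC; rewrite // in_setD jC.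
  by rewrite mu_cat mv1; apply: (connU dynkin_sym cC cu iC ju); rewrite eij orbT.
have uw : uniq (u ++ v1 ++ v2).
  by rewrite (perm_uniq (s2 := u ++ v)) // perm_cat2l.
have uuv2 : uniq (u ++ v2).
  by apply: subseq_uniq uw; rewrite cat_subseq ?suffix_subseq.
have Luv2 : L (X (u ++ v2)).
  by apply: IH => //; rewrite -sz !size_cat -sv ltn_add2l -{1}[size v2]add0n ltn_add2r.
have Lv1 : L (X v1).
  apply: IH; rewrite ?mv1 ?filter_uniq //; last by move: uuv; rewrite cat_uniq => /and3P[].
  rewrite -sz size_cat -sv; have [/set0Pn[y yu] _] := cu.
  have : (0 < size u)%N by rewrite lt0n size_eq0; apply: contraTneq yu => ->; rewrite mem_mu.
  by move=> u_gt0; rewrite addnCA -[X in (X < _)%N]addn0 ltn_add2l ltn_addr.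
have S1 := lie_swappable Luv2 Lv1.
(* After [S1] the word is [v1 ++ u ++ v2], and [v2] is shorter than [v]. *)
have S2 : swappable (v1 ++ u) v2.
  apply: IHk => //.
  - by rewrite -ltnS (leq_trans _ vk) // -sv -{1}[size v2]add0n ltn_add2r.
  - by rewrite -sz !size_cat -sv addnCA addnA.
  - by rewrite -catA uniq_catCA.
  - suff -> : mu ((v1 ++ u) ++ v2) = mu (u ++ v) by [].
    by apply: mu_perm; rewrite -catA perm_catCA perm_cat2l.
have [i j iv jv iC jC|c c0 E] := nmon_filter (C := C) (v := v).
  by apply: clC; rewrite // inE jC mem_mu.
rewrite -/v1 -/v2 (nmon_apart a12) scalerA in E; move: (c * _) E => k1 E.
have El : X (u ++ v) = k1 *: X ((u ++ v2) ++ v1).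
  by rewrite nmon_cat E -nichols_scaleAr -nmon_cat catA.
have Er : X (v ++ u) = k1 *: X (v2 ++ v1 ++ u).
  by rewrite nmon_cat E -nichols_scaleAl -nmon_cat -catA.
rewrite /swappable El Er scalerA [chi u v * _]mulrC -scalerA.
apply: eqLZ; apply: eqL_trans S1 _.
rewrite -(chi_permr u pv) chi_catr.
(* The two moves also carry [v2] past [v1] and [v1] past [v2]; these factors cancel by
   [chi_apart]. *)
have -> : chi u v1 * chi u v2 = chi (u ++ v2) v1 * chi (v1 ++ u) v2.
  rewrite !chi_catl -(mulrA (chi u v1)) (mulrA (chi v2 v1)) [chi v2 v1 * _]mulrC.
  by rewrite (chi_apart a12) mul1r.
by rewrite -scalerA catA; apply: eqLZ.
Qed.

Lemma mu_rot u v : mu (u ++ v) = mu (v ++ u).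
Proof. by apply: mu_perm; rewrite perm_catC. Qed.

(* With [xy] an edge, moving [xy] past [v] in one step or letter by letter gives
   [xyv] modulo L as two multiples of [vxy], differing by the factor
   [p_xy p_yx], which is not 1. *)
Lemma uniq_nmon_lie w : uniq w -> conn e (mu w) -> L (X w).
Proof.
have [m] := ubnP (size w); elim: m w => // m IHm w; rewrite ltnS leq_eqVlt.
case/predU1P=> [sz|]; last exact: IHm.
have {IHm} sw := swappable_conn (m := m) IHm.
(* Membership in L(V) survives rotation, since a single letter is connected and can be moved to the
   end modulo L(V). *)
have rot s : forall t, size (s ++ t) = m -> uniq (s ++ t) -> conn e (mu (s ++ t)) ->
    L (X (t ++ s)) -> L (X (s ++ t)).
  elim: s => [|x s IHs] t szt ut ct; first by rewrite cats0.
  move=> Lts; have sx : swappable [:: x] (s ++ t).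
    apply: sw _ [:: x] (s ++ t) (leqnn _) szt ut _ ct; rewrite (_ : mu _ = [set x]); first exact: conn1.
    by apply/setP=> j; rewrite !inE.
  apply: eqL_lie sx _; apply: (subspaceZ _ lie_subspace); rewrite -catA; apply: IHs.
  - by rewrite -szt /= !size_cat /= addn1 addnS.
  - by rewrite catA uniq_catC.
  - by rewrite catA mu_rot.
  - by rewrite -catA.
case: w sz => [|x w] sz uw cw; first by case: cw => /set0Pn[y]; rewrite mem_mu.
have c1 y : conn e (mu [:: y]).
  by rewrite (_ : mu _ = [set y]); [exact: conn1 | apply/setP=> j; rewrite !inE].
have [w0|w0] := eqVneq w [::]; first by rewrite w0; exact: lie_nmon1.
have : has (e x) w.
  have [|||i [j [/set1P -> jw xj]]] := conn_edge cw (K := [set x]).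
  - by rewrite sub1set mem_mu inE eqxx.
  - by apply/set0Pn; exists x; rewrite inE.
  - apply/eqP=> E; case: w w0 E uw {sz cw} => // y w _ E /=.
    have : y \in [set x] by rewrite E !inE eqxx orbT.
    by rewrite in_set1 => /eqP ->; rewrite inE eqxx.
  move: jw; rewrite !inE => /andP[/negPf ->] /= jw.
  by apply/hasP; exists j.
(* Splitting at the first neighbour [y] of [x] leaves [s] unlinked from [x]; so [x] can pass [s],
   and rotating [s] to the end brings the edge to the front. *)
move=> hw; case/split_find: hw uw cw sz {w0} => y s t xy nxs.
rewrite cat_rcons => uw cw sz.
have ax : apart [:: x] s.
  move=> i j; rewrite inE => /eqP -> js; rewrite (hasPn nxs) // andbT.
  by apply: contraTneq uw => ->; rewrite /= mem_cat js.
rewrite -cat1s catA nmon_cat (nmon_apart ax) -nichols_scaleAl -nmon_cat -catA.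
apply: (subspaceZ _ lie_subspace).
have pw : perm_eq (s ++ x :: y :: t) (x :: s ++ y :: t).
  by rewrite -(cat1s x (y :: t)) perm_catCA.
have pr : perm_eq ([:: x, y & t] ++ s) (x :: s ++ y :: t) by rewrite perm_catC.
apply: rot; rewrite ?(perm_size pw) ?(perm_uniq pw) ?(mu_perm pw) //.
have {}uw : uniq ([:: x; y] ++ t ++ s) by rewrite catA (perm_uniq pr).
have {}cw : conn e (mu ([:: x; y] ++ t ++ s)) by rewrite catA (mu_perm pr).
have {}sz : size ([:: x; y] ++ t ++ s) = m by rewrite catA (perm_size pr).
rewrite -[[:: x, y & t] ++ s]/([:: x; y] ++ t ++ s).
move: (t ++ s) uw cw sz => v uw cw sz {w s t ax nxs pw pr}.
have cxy : conn e (mu [:: x; y]).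
  rewrite (mu_cat [:: x] [:: y]); apply: (connU dynkin_sym (c1 x) (c1 y) (i := x) (j := y)).
  - by rewrite mem_mu inE.
  - by rewrite mem_mu inE.
  - by rewrite xy orbT.
have Sxy := sw _ [:: x; y] v (leqnn _) sz uw cxy cw.
have Sx : swappable [:: x] (y :: v) by exact: sw _ [:: x] (y :: v) (leqnn _) sz uw (c1 x) cw.
have pyx : perm_eq ([:: y] ++ v ++ [:: x]) ([:: x; y] ++ v) by rewrite catA perm_catC.
have Sy : swappable [:: y] (v ++ [:: x]).
  apply: (sw _ [:: y] (v ++ [:: x]) (leqnn _) _ _ (c1 y));
  by rewrite ?(perm_size pyx) ?(perm_uniq pyx) ?(mu_perm pyx).
have S := eqL_trans Sx (eqLZ (chi [:: x] (y :: v)) Sy).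
apply: (eqL_lie Sxy); apply: (subspaceZ _ lie_subspace).
have {S} S : eqL (X ([:: x; y] ++ v))
    ((p x y * p y x * chi [:: x; y] v) *: X (v ++ [:: x; y])).
  (* When [x] moves and then [y], each of the two passes the other once, hence the extra
     [p x y * p y x]. *)
  suff -> : p x y * p y x * chi [:: x; y] v = chi [:: x] (y :: v) * chi [:: y] (v ++ [:: x]).
    by rewrite -scalerA; move: S; rewrite -catA.
  rewrite (chi_catl [:: x] [:: y]) chi_cons1 chi_catr !chi11.
  by rewrite mulrACA [p y x * _]mulrC.
(* The coefficient is the difference of the scalars in [S] and [Sxy], two congruences for the same
   word. *)
apply: (@lieZ ((p x y * p y x - 1) * chi [:: x; y] v)).
  rewrite mulf_neq0 ?chi_neq0 // subr_eq0.
  by case/andP: xy.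
rewrite mulrBl mul1r scalerBl -(subrKA (X ([:: x; y] ++ v))).
apply: (subspaceD lie_subspace _ Sxy).
by rewrite -opprB -scaleN1r; apply: (subspaceZ _ lie_subspace).
Qed.

(** * The supports occurring in L(V), and the theorem *)

Lemma mu_enum_set (A : {set 'I_n}) : mu (enum A) = A.
Proof. by apply/setP=> i; rewrite mem_mu mem_enum. Qed.

(** A connected [A] is realised by the multilinear word [enum A]. Maximal supports thus become
    maximal connected sets, which are the components by [componentE]. *)
Lemma lie_supportE A : lie_support p A <-> conn e A.
Proof.
split=> [[w [_ nz Lw <-]]|cA]; first exact: lie_nmon_conn.
exists (enum A); rewrite mu_enum_set; split=> //.
- by have [/set0Pn[i iA] _] := cA; rewrite -size_eq0 -lt0n -cardE; apply/card_gt0P; exists i.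
- exact/nmon_uniq_neq0/enum_uniq.
- by apply: uniq_nmon_lie; rewrite ?enum_uniq ?mu_enum_set.
Qed.

Lemma uniq_nmon_lieE w : uniq w -> L (X w) <-> conn e (mu w).
Proof.
move=> uw; split=> [Lw|]; last exact: uniq_nmon_lie.
exact: lie_nmon_conn Lw (nmon_uniq_neq0 uw).
Qed.

End NicholsAlgebra.

Theorem theorem2p1 (F : closedFieldType) (F_char0 : [pchar F] =i pred0)
  (n : nat) (n_gt0 : (0 < n)%N)
  (p : 'M[F]_n) (p_neq0 : forall i j, p i j != 0) :
  (forall u : seq 'I_n, u != [::] -> nmon p u != 0 ->
     (is_component (dynkin p) (word_graph p u) <->
      is_maximal (lie_support p) (mu u)))
  /\
  [/\ is_connected (dynkin p) <-> nichols_lie (nmon p (rev (enum 'I_n))),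
      is_connected (dynkin p) <-> nichols_lie (nmon p (enum 'I_n))
    & is_connected (dynkin p) <->
      exists u : seq 'I_n, [/\ u != [::], nmon p u != 0,
        nichols_lie (nmon p u) & #|mu u| = n]].
Proof.
have supp := lie_supportE p_neq0.
have connT := is_connectedE (dynkin_sym p).
rewrite card_ord in connT; have {}connT := connT n_gt0.
have mu_enum : mu (enum 'I_n) = setT by apply/setP=> i; rewrite !inE mem_enum.
have mu_rev : mu (rev (enum 'I_n)) = setT.
  by rewrite -mu_enum; apply: mu_perm; rewrite perm_rev.
split.
  move=> u _ _; rewrite /word_graph componentE; last exact: dynkin_sym.
  by split=> -[/supp cu mu_max]; split=> // B /supp; apply: mu_max.
split.
- by rewrite connT uniq_nmon_lieE ?rev_uniq ?enum_uniq ?mu_rev.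
- by rewrite connT uniq_nmon_lieE ?enum_uniq ?mu_enum.
(* A support with [n] elements is the whole vertex set, so the last condition is
   [lie_support p setT]. *)
- rewrite connT -supp; split=> [[u [u0 nz Lu mu_u]]|[u [u0 nz Lu mu_u]]]; exists u.
    by rewrite mu_u cardsT card_ord.
  split=> //; apply/eqP; rewrite eqEcard subsetT cardsT card_ord.
  by rewrite mu_u leqnn.
Qed.
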